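(* Let $k$ be an algebraically closed field of characteristic zero and let $H$ be a semisimple Hopf algebra over $k$. Suppose that $A$ and $L$ are both normal Hopf subalgebras of $H$ such that $H=AL$ and $A\cap L=k$. Then $H\cong A\otimes L$ as Hopf algebras via the multiplication map $a\otimes l\mapsto al$.
   Context: A Hopf subalgebra $A\subseteq H$ is normal if $h_1 A S(h_2)\subseteq A$ and $S(h_1)Ah_2\subseteq A$ for all $h\in H$ (Sweedler notation, $S$ the antipode). $k$ also denotes the trivial Hopf subalgebra $k1_H$. $AL$ is the linear span of products $al$ with $a\in A$, $l\in L$. $A\otimes L$ carries the usual tensor product Hopf algebra structure. *)

(* Defs.v *)
From HB Require Import structures.
From mathcomp Require Import all_boot all_algebra.
From mathcomp Require Import boolp classical_sets.

Set Implicit Arguments.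
Unset Strict Implicit.
Unset Printing Implicit Defensive.

Import GRing.Theory.
Local Open Scope ring_scope.

Definition bilinear_map (k : fieldType) (V W U : lmodType k)
    (f : V -> W -> U) : Prop :=
  (forall w, linear (f^~ w)) /\ (forall v, linear (f v)).

(* The tensor product V (x) W, for vector spaces of arbitrary dimension: finite
   formal sums of pairs (v, w), two of them being identified when no bilinear
   map to a vector space separates them. Scalars need not be recorded in the
   formal sums, since c (v (x) w) = (c v) (x) w. *)
Section TensorSpace.
Variables (k : fieldType) (V W : lmodType k).

Definition eval_sum (U : lmodType k) (f : V -> W -> U) (s : seq (V * W)) : U :=
  \sum_(p <- s) f p.1 p.2.

Definition tensor_equiv (s t : seq (V * W)) : bool :=
  `[< forall (U : lmodType k) (f : V -> W -> U),
        bilinear_map f -> eval_sum f s = eval_sum f t >].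

Lemma tensor_equiv_refl : reflexive tensor_equiv.
Proof. by move=> s; apply/asboolP. Qed.

Lemma tensor_equiv_sym : symmetric tensor_equiv.
Proof.
by move=> s t; apply/idP/idP => /asboolP st; apply/asboolP => U f bf;
  rewrite st.
Qed.

Lemma tensor_equiv_trans : transitive tensor_equiv.
Proof.
move=> t s u /asboolP st /asboolP tu; apply/asboolP => U f bf.
by rewrite st ?tu.
Qed.

Canonical tensor_equiv_rel :=
  EquivRel tensor_equiv tensor_equiv_refl tensor_equiv_sym tensor_equiv_trans.

Definition tensor : Type := {eq_quot tensor_equiv}%qT.

HB.instance Definition _ := Choice.on tensor.
HB.instance Definition _ := EqQuotient.on tensor.

Definition tens_sum (s : seq (V * W)) : tensor := (\pi_tensor s)%qT.
Definition tens (v : V) (w : W) : tensor := tens_sum [:: (v, w)].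

Definition tlift (U : lmodType k) (f : V -> W -> U) (x : tensor) : U :=
  eval_sum f (repr x).

Lemma tens_sum_eqP s t : tens_sum s = tens_sum t <->
  forall (U : lmodType k) (f : V -> W -> U),
    bilinear_map f -> eval_sum f s = eval_sum f t.
Proof.
split=> [/eqquotP/asboolP //|st].
by apply/eqquotP/asboolP.
Qed.

Lemma repr_tensK x : tens_sum (repr x) = x.
Proof. exact: reprK. Qed.

Lemma tensorP x y :
  (forall (U : lmodType k) (f : V -> W -> U),
    bilinear_map f -> tlift f x = tlift f y) -> x = y.
Proof.
by move=> xy; rewrite -[x]repr_tensK -[y]repr_tensK; apply/tens_sum_eqP.
Qed.

Lemma tlift_sum (U : lmodType k) (f : V -> W -> U) s :
  bilinear_map f -> tlift f (tens_sum s) = eval_sum f s.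
Proof.
move=> bf; rewrite /tlift.
by have /tens_sum_eqP := repr_tensK (tens_sum s); apply.
Qed.

Definition tensor_add (x y : tensor) := tens_sum (repr x ++ repr y).
Definition tensor_scale (c : k) (x : tensor) :=
  tens_sum [seq (c *: p.1, p.2) | p <- repr x].

Lemma bilinear_map0l (U : lmodType k) (f : V -> W -> U) w :
  bilinear_map f -> f 0 w = 0.
Proof. by case=> fl _; have := fl w (- 1) 0 0; rewrite scaler0 addr0 scaleN1r addNr. Qed.

Lemma bilinear_mapZl (U : lmodType k) (f : V -> W -> U) c v w :
  bilinear_map f -> f (c *: v) w = c *: f v w.
Proof.
move=> bf; have [fl _] := bf.
by have := fl w c v 0; rewrite !addr0 bilinear_map0l // addr0.
Qed.

Lemma tlift_add (U : lmodType k) (f : V -> W -> U) x y : bilinear_map f ->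
  tlift f (tensor_add x y) = tlift f x + tlift f y.
Proof. by move=> bf; rewrite tlift_sum // /eval_sum big_cat. Qed.

Lemma tlift_scale (U : lmodType k) (f : V -> W -> U) c x : bilinear_map f ->
  tlift f (tensor_scale c x) = c *: tlift f x.
Proof.
move=> bf; rewrite tlift_sum // /eval_sum big_map scaler_sumr.
by apply: eq_bigr => p _; rewrite bilinear_mapZl.
Qed.

Lemma tlift_zero (U : lmodType k) (f : V -> W -> U) : bilinear_map f ->
  tlift f (tens_sum [::]) = 0.
Proof. by move=> bf; rewrite tlift_sum // /eval_sum big_nil. Qed.

Let tE := (tlift_add, tlift_scale, tlift_zero).

Fact tensor_addA : associative tensor_add.
Proof. by move=> x y z; apply: tensorP => U f bf; rewrite !tE // addrA. Qed.
Fact tensor_addC : commutative tensor_add.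
Proof. by move=> x y; apply: tensorP => U f bf; rewrite !tE // addrC. Qed.
Fact tensor_add0 : left_id (tens_sum [::]) tensor_add.
Proof. by move=> x; apply: tensorP => U f bf; rewrite !tE // add0r. Qed.
Fact tensor_addN :
  left_inverse (tens_sum [::]) (tensor_scale (- 1)) tensor_add.
Proof.
by move=> x; apply: tensorP => U f bf; rewrite !tE // scaleN1r addNr.
Qed.

HB.instance Definition _ := GRing.isZmodule.Build tensor
  tensor_addA tensor_addC tensor_add0 tensor_addN.

Fact tensor_scaleA a b x :
  tensor_scale a (tensor_scale b x) = tensor_scale (a * b) x.
Proof. by apply: tensorP => U f bf; rewrite !tE // scalerA. Qed.
Fact tensor_scale1 : left_id 1 tensor_scale.
Proof. by move=> x; apply: tensorP => U f bf; rewrite !tE // scale1r. Qed.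
Fact tensor_scaleDr : right_distributive tensor_scale +%R.
Proof. by move=> c x y; apply: tensorP => U f bf; rewrite !tE // scalerDr. Qed.
Fact tensor_scaleDl x : {morph tensor_scale^~ x : a b / a + b}.
Proof. by move=> a b; apply: tensorP => U f bf; rewrite !tE // scalerDl. Qed.

HB.instance Definition _ := GRing.Zmodule_isLmodule.Build k tensor
  tensor_scaleA tensor_scale1 tensor_scaleDr tensor_scaleDl.

Lemma tensor_linE (c : k) (x y : tensor) :
  c *: x + y = tensor_add (tensor_scale c x) y.
Proof. by []. Qed.

Lemma tens_bilinear : bilinear_map tens.
Proof.
split=> [w c v v'|v c w w']; apply: tensorP => U f bf;
  rewrite tensor_linE !tE // !tlift_sum //;
  rewrite /eval_sum !big_seq1 /=; case: (bf) => fl fr; first exact: fl.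
exact: fr.
Qed.

Lemma tlift_linear (U : lmodType k) (f : V -> W -> U) :
  bilinear_map f -> linear (tlift f).
Proof. by move=> bf c x y; rewrite tensor_linE !tE. Qed.

Lemma tlift_param (U : lmodType k) (f g h : V -> W -> U) c x :
  (forall v w, f v w = c *: g v w + h v w) ->
  tlift f x = c *: tlift g x + tlift h x.
Proof.
move=> fgh; rewrite /tlift /eval_sum scaler_sumr -big_split.
by apply: eq_bigr => p _; apply: fgh.
Qed.

Lemma tlift_tens (U : lmodType k) (f : V -> W -> U) v w :
  bilinear_map f -> tlift f (tens v w) = f v w.
Proof. by move=> bf; rewrite tlift_sum // /eval_sum big_seq1. Qed.

Lemma tensor_sumE x : exists s : seq (V * W), x = \sum_(p <- s) tens p.1 p.2.
Proof.
exists (repr x); rewrite -[LHS]repr_tensK; elim: (repr x) => [|p s IHs].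
  by rewrite big_nil.
rewrite big_cons -IHs; apply: tensorP => U f bf.
rewrite [_ + _]/(tensor_add _ _) !tE // !tlift_sum //.
by rewrite /eval_sum big_cons big_seq1.
Qed.

Lemma tensor_ext (U : lmodType k) (f g : tensor -> U) :
  linear f -> linear g -> (forall v w, f (tens v w) = g (tens v w)) -> f =1 g.
Proof.
move=> lf lg fg x.
have [s ->] := tensor_sumE x.
pose F := HB.pack f (GRing.isLinear.Build _ _ _ _ f lf) : {linear tensor -> U}.
pose G := HB.pack g (GRing.isLinear.Build _ _ _ _ g lg) : {linear tensor -> U}.
rewrite -[f]/(F : _ -> _) -[g]/(G : _ -> _) !linear_sum.
by apply: eq_bigr => p _; apply: fg.
Qed.
End TensorSpace.

Lemma linear_retract (k : fieldType) (U V : lmodType k) (i : {linear U -> V}) :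
  injective i -> exists r : {linear V -> U}, cancel i r.
Proof.
move=> i_inj.
pose lin_cl (Q : set V) := forall (a : k) u v, Q u -> Q v -> Q (a *: u + v).
pose P (Q : set V) := lin_cl Q /\ forall u, Q (i u) -> u = 0.
have [Q [[Qlin Q0] Qmax]] : exists Q, P Q /\ forall B, (Q `<` B)%classic -> ~ P B.
  apply: Zorn_bigcup => F FP Ftot; split=> [a u v [X FX Xu] [Y FY Yv]|u [X FX]].
    have [XY|YX] := Ftot X Y FX FY.
      by exists Y => //; apply: (FP Y FY).1 => //; apply: XY.
    by exists X => //; apply: (FP X FX).1 => //; apply: YX.
  exact: (FP X FX).2.
have Qz : Q 0.
  pose B : set V := fun v => Q v \/ v = 0.
  have PB : P B.
    split=> [a u v [Qu|->] [Qv|->]|u [/Q0//|]].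
    - by left; apply: Qlin.
    - have Qz : Q 0 by have := Qlin (- 1) _ _ Qu Qu; rewrite scaleN1r addNr.
      by left; apply: Qlin.
    - by left; rewrite scaler0 add0r.
    - by right; rewrite scaler0 add0r.
    - by rewrite -(linear0 i) => /i_inj.
  apply: contrapT => nQ0; apply: (Qmax B) => //; split; last by move/(_ 0 (or_intror erefl)).
  by move=> v Qv; left.
have QB u v : Q u -> Q v -> Q (u - v).
  by move=> Qu Qv; have := Qlin (- 1) _ _ Qv Qu; rewrite scaleN1r addrC.
have QZ a u : Q u -> Q (a *: u).
  by move=> Qu; have := Qlin a _ _ Qu Qz; rewrite addr0.
have ex v : exists u, Q (v - i u).
  apply: contrapT => nex.
  pose B : set V := fun w => exists c : k, Q (w - c *: v).
  have QsB : (Q `<=` B)%classic by move=> w Qw; exists 0; rewrite scale0r subr0.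
  apply: (Qmax B).
    split=> // BQ; apply: nex; exists 0; rewrite linear0 subr0.
    by apply: BQ; exists 1; rewrite scale1r subrr.
  split=> [a u w [c Qu] [d Qw]|u [c Qu]].
    exists (a * c + d); rewrite scalerDl -scalerA opprD addrACA -scalerBr.
    exact: Qlin.
  have [c0|c0] := eqVneq c 0.
    by apply: Q0; move: Qu; rewrite c0 scale0r subr0.
  case: nex; exists (c^-1 *: u); rewrite linearZ /=.
  have := QZ (- c^-1) _ Qu.
  by rewrite scalerBr scalerA mulNr mulVf // !scaleNr scale1r opprK addrC.
have [r rP] := choice ex.
have rU v u : Q (v - i u) -> r v = u.
  move=> Qu; apply/eqP; rewrite -subr_eq0; apply/eqP/Q0.
  have -> : i (r v - u) = (v - i u) - (v - i (r v)).
    by rewrite opprB [RHS]addrC addrA subrK linearB.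
  exact: QB.
have r_lin : linear r.
  move=> a u v; apply: rU; rewrite linearP opprD addrACA -scalerBr.
  exact: Qlin.
pose R := HB.pack r (GRing.isLinear.Build _ _ _ _ r r_lin) : {linear V -> U}.
exists R => u.
by apply: rU; rewrite subrr.
Qed.

Definition tmap (k : fieldType) (V V' W W' : lmodType k)
    (f : V -> V') (g : W -> W') : tensor V W -> tensor V' W' :=
  tlift (fun v w => tens (f v) (g w)).

Section TensorMap.
Variable k : fieldType.

Lemma tens_linl (V W : lmodType k) (w : W) : linear (fun v : V => tens v w).
Proof. by case: (tens_bilinear V W) => tl _; apply: tl. Qed.

Lemma tens_linr (V W : lmodType k) (v : V) : linear (fun w : W => tens v w).
Proof. by case: (tens_bilinear V W) => _ tr; apply: tr. Qed.

Section Map.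
Variables (V V' W W' : lmodType k).
Variables (f : {linear V -> V'}) (g : {linear W -> W'}).

Lemma tmap_bilinear : bilinear_map (fun v w => tens (f v) (g w)).
Proof.
by split=> [w|v] c x y /=; rewrite linearP ?tens_linl ?tens_linr.
Qed.

Lemma tmapE v w : tmap f g (tens v w) = tens (f v) (g w).
Proof. by rewrite /tmap tlift_tens //; apply: tmap_bilinear. Qed.

Lemma tmap_linear : linear (tmap f g).
Proof. exact: tlift_linear tmap_bilinear. Qed.

HB.instance Definition _ :=
  GRing.isLinear.Build k (tensor V W) (tensor V' W') _ (tmap f g) tmap_linear.
End Map.

Lemma tmap_inj (V V' W W' : lmodType k)
    (f : {linear V -> V'}) (g : {linear W -> W'}) :
  injective f -> injective g -> injective (tmap f g).
Proof.
move=> /linear_retract[f' fK] /linear_retract[g' gK].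
apply: (can_inj (g := tmap f' g')).
apply: (tensor_ext (f := tmap f' g' \o tmap f g)); first exact: linearP.
  by move=> c x y.
by move=> v w; rewrite /= !tmapE fK gK.
Qed.

Variables (U V W : lmodType k).

Definition tassoc : tensor (tensor U V) W -> tensor U (tensor V W) :=
  tlift (fun x w => tlift (fun (u : U) (v : V) => tens u (tens v w)) x).

Let tassoc_bil1 (w : W) : bilinear_map (fun (u : U) (v : V) => tens u (tens v w)).
Proof. by split=> [v|u] c x y /=; rewrite ?tens_linl ?tens_linr. Qed.

Let tassoc_bil2 : bilinear_map
  (fun (x : tensor U V) (w : W) => tlift (fun (u : U) (v : V) => tens u (tens v w)) x).
Proof.
split=> [w|x] c; first exact: tlift_linear.
by move=> w w'; apply: tlift_param => u v; rewrite !tens_linr.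
Qed.

Lemma tassoc_linear : linear tassoc.
Proof. exact: tlift_linear. Qed.

HB.instance Definition _ := GRing.isLinear.Build k
  (tensor (tensor U V) W) (tensor U (tensor V W)) _ tassoc tassoc_linear.

Lemma tassocE u v w : tassoc (tens (tens u v) w) = tens u (tens v w).
Proof. by rewrite /tassoc !tlift_tens. Qed.
End TensorMap.

Section TensorAlgebra.
Variables (k : fieldType) (A B : algType k).

Definition tensor_one : tensor A B := tens 1 1.
Definition tensor_mul (x y : tensor A B) : tensor A B :=
  tlift (fun a b => tlift (fun c d => tens (a * c) (b * d)) y) x.

Let mul_bil1 (a : A) (b : B) :
  bilinear_map (fun (c : A) (d : B) => tens (a * c) (b * d)).
Proof.
by split=> [d|c] e u v; rewrite mulrDr -scalerAr ?tens_linl ?tens_linr.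
Qed.

Let mul_bil2 (y : tensor A B) :
  bilinear_map (fun (a : A) (b : B) => tlift (fun c d => tens (a * c) (b * d)) y).
Proof.
by split=> [b|a] e u v; apply: tlift_param => c d;
  rewrite mulrDl -scalerAl ?tens_linl ?tens_linr.
Qed.

Lemma tensor_mul_linl y : linear (fun x => tensor_mul x y).
Proof. exact: tlift_linear. Qed.

Lemma tensor_mul_linr x : linear (tensor_mul x).
Proof.
by move=> e u v; apply: tlift_param => a b; rewrite (tlift_linear (mul_bil1 _ _)).
Qed.

Lemma tensor_mulE (a c : A) (b d : B) :
  tensor_mul (tens a b) (tens c d) = tens (a * c) (b * d).
Proof. by rewrite /tensor_mul !tlift_tens. Qed.

Let linid (V : lmodType k) : linear (fun x : V => x).
Proof. by []. Qed.

Fact tensor_mulA : associative tensor_mul.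
Proof.
move=> x y z.
apply: (tensor_ext (f := fun x => tensor_mul x (tensor_mul y z))
                   (g := fun x => tensor_mul (tensor_mul x y) z)) x.
- exact: tensor_mul_linl.
- by move=> c u v; rewrite !tensor_mul_linl.
move=> a b.
apply: (tensor_ext (f := fun y => tensor_mul _ (tensor_mul y z))
                   (g := fun y => tensor_mul (tensor_mul _ y) z)) y.
- by move=> c u v; rewrite tensor_mul_linl tensor_mul_linr.
- by move=> c u v; rewrite tensor_mul_linr tensor_mul_linl.
move=> c d.
apply: (tensor_ext (f := fun z => tensor_mul _ (tensor_mul _ z))
                   (g := tensor_mul _)) z.
- by move=> e u v; rewrite !tensor_mul_linr.
- exact: tensor_mul_linr.
by move=> e f; rewrite !tensor_mulE !mulrA.
Qed.

Fact tensor_mul1 : left_id tensor_one tensor_mul.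
Proof.
apply: tensor_ext => [||a b]; [exact: tensor_mul_linr | exact: linid |].
by rewrite tensor_mulE !mul1r.
Qed.

Fact tensor_mulr1 : right_id tensor_one tensor_mul.
Proof.
apply: tensor_ext => [||a b]; [exact: tensor_mul_linl | exact: linid |].
by rewrite tensor_mulE !mulr1.
Qed.

Fact tensor_mulDl : left_distributive tensor_mul +%R.
Proof.
by move=> x y z; have := tensor_mul_linl z 1 x y; rewrite !scale1r.
Qed.

Fact tensor_mulDr : right_distributive tensor_mul +%R.
Proof.
by move=> x y z; have := tensor_mul_linr x 1 y z; rewrite !scale1r.
Qed.

Fact tensor_one_neq0 : tensor_one != 0.
Proof.
have aug (C : algType k) : exists r : {linear C -> k^o}, r 1 = 1.
  pose e (c : k^o) : C := c%:A.
  have e_lin : linear e by move=> c u v; rewrite /e scalerDl scalerA.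
  pose E := HB.pack e (GRing.isLinear.Build _ _ _ _ e e_lin) : {linear k^o -> C}.
  have /linear_retract[r rK] : injective E by exact: (fmorph_inj (in_alg C)).
  by exists r; rewrite -[RHS]rK /= /e scale1r.
have [[r r1] [q q1]] := (aug A, aug B).
have rq : bilinear_map (fun a b => r a * q b : k^o).
  split=> [b|a] c u v; rewrite linearP ?mulrDl ?mulrDr -?scalerAl //.
  by rewrite -scalerAr.
apply/eqP => /(congr1 (tlift (fun a b => r a * q b : k^o))).
rewrite tlift_tens // r1 q1 mulr1.
have /= -> := tlift_zero rq.
by move/eqP; rewrite oner_eq0.
Qed.

HB.instance Definition _ := GRing.Zmodule_isNzRing.Build (tensor A B)
  tensor_mulA tensor_mul1 tensor_mulr1 tensor_mulDl tensor_mulDr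
  tensor_one_neq0.

Let tensor_mul_mul : tensor_mul = *%R.
Proof. by []. Qed.

Fact tensor_scaleAl (c : k) (x y : tensor A B) : c *: (x * y) = (c *: x) * y.
Proof.
have := tensor_mul_linl y c x 0.
by rewrite tensor_mul_mul mul0r !addr0 => ->.
Qed.

Fact tensor_scaleAr (c : k) (x y : tensor A B) : c *: (x * y) = x * (c *: y).
Proof.
have := tensor_mul_linr x c y 0.
by rewrite tensor_mul_mul mulr0 !addr0 => ->.
Qed.

HB.instance Definition _ :=
  GRing.Lmodule_isLalgebra.Build k (tensor A B) tensor_scaleAl.
HB.instance Definition _ :=
  GRing.Lalgebra_isAlgebra.Build k (tensor A B) tensor_scaleAr.

Lemma tens1 : tens 1 1 = 1 :> tensor A B.
Proof. by []. Qed.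

Lemma tensM (a c : A) (b d : B) : tens a b * tens c d = tens (a * c) (b * d).
Proof. exact: tensor_mulE. Qed.
End TensorAlgebra.

(* In the axioms, tlift (fun h1 h2 => E) (comul h) is the Sweedler sum of the
   E for comul h = h1 (x) h2. *)
Record hopfAlgType (k : fieldType) := HopfAlg {
  hopf_alg :> algType k;
  comul : hopf_alg -> tensor hopf_alg hopf_alg;
  counit : hopf_alg -> k;
  antipode : hopf_alg -> hopf_alg;
  comul_linear : linear comul;
  comul_monoid : monoid_morphism comul;
  counit_linear : scalar counit;
  counit_monoid : monoid_morphism counit;
  antipode_linear : linear antipode;
  comulA : forall h, tassoc (tmap comul idfun (comul h)) = tmap idfun comul (comul h);
  counitl : forall h, tlift (fun h1 h2 => counit h1 *: h2) (comul h) = h;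
  counitr : forall h, tlift (fun h1 h2 => counit h2 *: h1) (comul h) = h;
  antipodel : forall h,
    tlift (fun h1 h2 => antipode h1 * h2) (comul h) = (counit h)%:A;
  antipoder : forall h,
    tlift (fun h1 h2 => h1 * antipode h2) (comul h) = (counit h)%:A
}.

Arguments comul {k H} _ : rename.
Arguments counit {k H} _ : rename.
Arguments antipode {k H} _ : rename.

Section HopfOperations.
Variables (k : fieldType) (H : hopfAlgType k).
HB.instance Definition _ := GRing.isLinear.Build k H (tensor H H) _
  (@comul k H) (@comul_linear k H).
HB.instance Definition _ := GRing.isMonoidMorphism.Build H (tensor H H)
  (@comul k H) (@comul_monoid k H).
HB.instance Definition _ := GRing.isLinear.Build k H k *%R
  (@counit k H) (@counit_linear k H).
HB.instance Definition _ := GRing.isMonoidMorphism.Build H k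
  (@counit k H) (@counit_monoid k H).
HB.instance Definition _ := GRing.isLinear.Build k H H _
  (@antipode k H) (@antipode_linear k H).
End HopfOperations.

Record hopf_morphism (k : fieldType) (G H : hopfAlgType k) (f : G -> H) : Prop :=
  HopfMorphism {
    hopf_morphism_linear : linear f;
    hopf_morphism_monoid : monoid_morphism f;
    hopf_morphism_comul : forall x, comul (f x) = tmap f f (comul x);
    hopf_morphism_counit : forall x, counit (f x) = counit x;
    hopf_morphism_antipode : forall x, antipode (f x) = f (antipode x)
  }.

Definition hopf_isomorphism (k : fieldType) (G H : hopfAlgType k) (f : G -> H) :=
  hopf_morphism f /\ bijective f.

Lemma tensor_ind (k : fieldType) (V W : lmodType k) (P : tensor V W -> Prop) :
  P 0 -> (forall x y, P x -> P y -> P (x + y)) ->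
  (forall v w, P (tens v w)) -> forall x, P x.
Proof.
move=> P0 PD Pt x; have [s ->] := tensor_sumE x.
by elim/big_ind: _ => //.
Qed.

Lemma tlift0 (k : fieldType) (V W U : lmodType k) (f : V -> W -> U) :
  bilinear_map f -> tlift f 0 = 0.
Proof. by move=> bf; have := tlift_zero bf. Qed.

Lemma tliftD (k : fieldType) (V W U : lmodType k) (f : V -> W -> U) x y :
  bilinear_map f -> tlift f (x + y) = tlift f x + tlift f y.
Proof.
by move=> bf; have := tlift_linear bf 1 x y; rewrite !scale1r.
Qed.

Lemma tens0l (k : fieldType) (V W : lmodType k) (w : W) : tens (0 : V) w = 0.
Proof. by have := tens_linl w (- 1) (0 : V) 0; rewrite scaler0 addr0 scaleN1r addNr. Qed.
Lemma tens0r (k : fieldType) (V W : lmodType k) (v : V) : tens v (0 : W) = 0.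
Proof. by have := tens_linr v (- 1) (0 : W) 0; rewrite scaler0 addr0 scaleN1r addNr. Qed.
Lemma tensDl (k : fieldType) (V W : lmodType k) (v v' : V) (w : W) :
  tens (v + v') w = tens v w + tens v' w.
Proof. by have := tens_linl w 1 v v'; rewrite !scale1r. Qed.
Lemma tensDr (k : fieldType) (V W : lmodType k) (v : V) (w w' : W) :
  tens v (w + w') = tens v w + tens v w'.
Proof. by have := tens_linr v 1 w w'; rewrite !scale1r. Qed.
Lemma tensZl (k : fieldType) (V W : lmodType k) c (v : V) (w : W) :
  tens (c *: v) w = c *: tens v w.
Proof. by have := tens_linl w c v 0; rewrite tens0l !addr0. Qed.
Lemma tensZr (k : fieldType) (V W : lmodType k) c (v : V) (w : W) :
  tens v (c *: w) = c *: tens v w.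
Proof. by have := tens_linr v c w 0; rewrite tens0r !addr0. Qed.

Section BilinearMaps.
Variable k : fieldType.

Lemma bilinear_scalel (V W : lmodType k) (e : {linear V -> k | *%R}) :
  bilinear_map (fun (v : V) (w : W) => e v *: w).
Proof.
split=> [w|v] c x y /=; first by rewrite linearP scalerDl scalerA.
by rewrite scalerDr !scalerA mulrC.
Qed.

Lemma bilinear_scaler (V W : lmodType k) (e : {linear W -> k | *%R}) :
  bilinear_map (fun (v : V) (w : W) => e w *: v).
Proof.
split=> [w|v] c x y /=; last by rewrite linearP scalerDl scalerA.
by rewrite scalerDr !scalerA mulrC.
Qed.

Lemma bilinear_mul (V W : lmodType k) (C : algType k)
    (f : {linear V -> C}) (g : {linear W -> C}) :
  bilinear_map (fun v w => f v * g w).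
Proof.
split=> [w|v] c x y /=; first by rewrite linearP mulrDl scalerAl.
by rewrite linearP mulrDr scalerAr.
Qed.

Lemma bilinear_mul_scalar (V W : lmodType k)
    (f : {linear V -> k | *%R}) (g : {linear W -> k | *%R}) :
  bilinear_map (fun v w => f v * g w : k^o).
Proof.
split=> [w|v] c x y /=; first by rewrite linearP mulrDl -mulrA.
by rewrite linearP mulrDr mulrCA.
Qed.

Lemma tmapM (A A' B B' : algType k) (f : {lrmorphism A -> A'})
    (g : {lrmorphism B -> B'}) : {morph tmap f g : x y / x * y}.
Proof.
move=> x y; elim/tensor_ind: x => [|x x' IHx IHx'|a b].
- by rewrite mul0r linear0 mul0r.
- by rewrite mulrDl !linearD /= mulrDl IHx IHx'.
elim/tensor_ind: y => [|y y' IHy IHy'|c d].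
- by rewrite mulr0 linear0 mulr0.
- by rewrite mulrDr !linearD /= mulrDr IHy IHy'.
by rewrite tensM !tmapE tensM !rmorphM.
Qed.

Section Mid.
Variables (V V' W W' : lmodType k).

(* (v (x) v') (x) (w (x) w') |-> (v (x) w) (x) (v' (x) w') *)
Definition tmid :
    tensor (tensor V V') (tensor W W') -> tensor (tensor V W) (tensor V' W') :=
  tlift (fun x y =>
    tlift (fun v v' => tlift (fun w w' => tens (tens v w) (tens v' w')) y) x).

Let tmid_bil1 (v : V) (v' : V') :
  bilinear_map (fun (w : W) (w' : W') => tens (tens v w) (tens v' w')).
Proof. by split=> [w'|w] c x y /=; rewrite ?(tens_linl, tens_linr). Qed.

Let tmid_bil2 (y : tensor W W') : bilinear_map (fun (v : V) (v' : V') =>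
  tlift (fun w w' => tens (tens v w) (tens v' w')) y).
Proof.
by split=> [v'|v] c x x'; apply: tlift_param => w w';
  rewrite ?(tens_linl, tens_linr).
Qed.

Let tmid_bil3 : bilinear_map (fun (x : tensor V V') (y : tensor W W') =>
  tlift (fun v v' => tlift (fun w w' => tens (tens v w) (tens v' w')) y) x).
Proof.
split=> [y|x] c u u'; first by rewrite (tlift_linear (tmid_bil2 _)).
by apply: tlift_param => v v'; rewrite (tlift_linear (tmid_bil1 _ _)).
Qed.

Lemma tmid_linear : linear tmid.
Proof. exact: tlift_linear. Qed.

HB.instance Definition _ := GRing.isLinear.Build k
  (tensor (tensor V V') (tensor W W')) (tensor (tensor V W) (tensor V' W'))
  _ tmid tmid_linear.

Lemma tmidE v v' w w' :
  tmid (tens (tens v v') (tens w w')) = tens (tens v w) (tens v' w').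
Proof. by rewrite /tmid !tlift_tens. Qed.
End Mid.

Lemma tmidM (A A' B B' : algType k) :
  {morph @tmid A A' B B' : x y / x * y}.
Proof.
move=> x y; elim/tensor_ind: x => [|x x' IHx IHx'|x1 x2].
- by rewrite mul0r linear0 mul0r.
- by rewrite mulrDl !linearD /= mulrDl IHx IHx'.
elim/tensor_ind: y => [|y y' IHy IHy'|y1 y2].
- by rewrite mulr0 linear0 mulr0.
- by rewrite mulrDr !linearD /= mulrDr IHy IHy'.
rewrite tensM.
elim/tensor_ind: x1 => [|x x' IHx IHx'|a a'].
- by rewrite mul0r !tens0l linear0 mul0r.
- by rewrite mulrDl !tensDl !linearD /= mulrDl IHx IHx'.
elim/tensor_ind: x2 => [|x x' IHx IHx'|b b'].
- by rewrite mul0r !tens0r linear0 mul0r.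
- by rewrite mulrDl !tensDr !linearD /= mulrDl IHx IHx'.
elim/tensor_ind: y1 => [|y y' IHy IHy'|c c'].
- by rewrite mulr0 !tens0l linear0 mulr0.
- by rewrite mulrDr !tensDl !linearD /= mulrDr IHy IHy'.
elim/tensor_ind: y2 => [|y y' IHy IHy'|d d'].
- by rewrite mulr0 !tens0r linear0 mulr0.
- by rewrite mulrDr !tensDr !linearD /= mulrDr IHy IHy'.
by rewrite !tensM !tmidE !tensM.
Qed.
End BilinearMaps.

Section TensorHopf.
Variables (k : fieldType) (A B : hopfAlgType k).

Definition tensor_comul (x : tensor A B) : tensor (tensor A B) (tensor A B) :=
  tmid (tmap comul comul x).

Definition tensor_counit (x : tensor A B) : k :=
  tlift (fun (a : A) (b : B) => counit a * counit b : k^o) x.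

Definition tensor_antipode : tensor A B -> tensor A B := tmap antipode antipode.

Fact tensor_comul_linear : linear tensor_comul.
Proof. by move=> c x y; rewrite /tensor_comul !linearP. Qed.

Fact tensor_comul_monoid : monoid_morphism tensor_comul.
Proof.
split; last by move=> x y; rewrite /tensor_comul tmapM tmidM.
by rewrite /tensor_comul -tens1 tmapE !rmorph1 -!tens1 tmidE.
Qed.

HB.instance Definition _ := GRing.isLinear.Build k (tensor A B)
  (tensor (tensor A B) (tensor A B)) _ tensor_comul tensor_comul_linear.
HB.instance Definition _ := GRing.isMonoidMorphism.Build (tensor A B)
  (tensor (tensor A B) (tensor A B)) tensor_comul tensor_comul_monoid.

Let counit_bil := bilinear_mul_scalar (@counit k A) (@counit k B).

Fact tensor_counit_linear : scalar tensor_counit.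
Proof. exact: tlift_linear counit_bil. Qed.

HB.instance Definition _ := GRing.isLinear.Build k (tensor A B) k *%R
  tensor_counit tensor_counit_linear.

Lemma tensor_comulE a b :
  tensor_comul (tens a b) = tmid (tens (comul a) (comul b)).
Proof. by rewrite /tensor_comul tmapE. Qed.

Lemma tensor_counitE a b : tensor_counit (tens a b) = counit a * counit b.
Proof. by rewrite /tensor_counit tlift_tens. Qed.

Lemma tensor_antipodeE a b :
  tensor_antipode (tens a b) = tens (antipode a) (antipode b).
Proof. exact: tmapE. Qed.

Fact tensor_counit_monoid : monoid_morphism tensor_counit.
Proof.
split=> [|x y]; first by rewrite -tens1 tensor_counitE !rmorph1 mulr1.
elim/tensor_ind: x => [|x x' IHx IHx'|a b].
- by rewrite mul0r linear0 mul0r.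
- by rewrite mulrDl !linearD /= mulrDl IHx IHx'.
elim/tensor_ind: y => [|y y' IHy IHy'|c d].
- by rewrite mulr0 linear0 mulr0.
- by rewrite mulrDr !linearD /= mulrDr IHy IHy'.
by rewrite tensM !tensor_counitE !rmorphM mulrACA.
Qed.

HB.instance Definition _ := GRing.isMonoidMorphism.Build (tensor A B) k
  tensor_counit tensor_counit_monoid.

Fact tensor_antipode_linear : linear tensor_antipode.
Proof. exact: linearP. Qed.

HB.instance Definition _ := GRing.isLinear.Build k (tensor A B) (tensor A B) _
  tensor_antipode tensor_antipode_linear.

Let tmid3 (x : tensor A (tensor A A)) (y : tensor B (tensor B B)) :=
  tmap idfun (@tmid k A A B B) (tmid (tens x y)).

Let tmid3_0l y : tmid3 0 y = 0.
Proof. by rewrite /tmid3 tens0l !linear0. Qed.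
Let tmid3_0r x : tmid3 x 0 = 0.
Proof. by rewrite /tmid3 tens0r !linear0. Qed.
Let tmid3_Dl x x' y : tmid3 (x + x') y = tmid3 x y + tmid3 x' y.
Proof. by rewrite /tmid3 tensDl !linearD. Qed.
Let tmid3_Dr x y y' : tmid3 x (y + y') = tmid3 x y + tmid3 x y'.
Proof. by rewrite /tmid3 tensDr !linearD. Qed.

Fact tensor_comulA x :
  tassoc (tmap tensor_comul idfun (tensor_comul x)) =
  tmap idfun tensor_comul (tensor_comul x).
Proof.
elim/tensor_ind: x => [|x y IHx IHy|a b]; first by rewrite !linear0.
  by rewrite !linearD /= IHx IHy.
rewrite tensor_comulE.
have L p q : tassoc (tmap tensor_comul idfun (tmid (tens p q))) =
    tmid3 (tassoc (tmap comul idfun p)) (tassoc (tmap comul idfun q)).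
  elim/tensor_ind: p => [|p p' IHp IHp'|a1 a2].
  - by rewrite tens0l !linear0 tmid3_0l.
  - by rewrite tensDl !linearD /= tmid3_Dl IHp IHp'.
  elim/tensor_ind: q => [|q q' IHq IHq'|b1 b2].
  - by rewrite tens0r !linear0 tmid3_0r.
  - by rewrite tensDr !linearD /= tmid3_Dr IHq IHq'.
  rewrite tmidE !tmapE /= tensor_comulE.
  move: (comul a1) (comul b1) => r s.
  elim/tensor_ind: r => [|r r' IHr IHr'|r1 r2].
  - by rewrite !tens0l !linear0 tens0l linear0 tmid3_0l.
  - by rewrite !tensDl !linearD /= tensDl linearD /= tmid3_Dl IHr IHr'.
  elim/tensor_ind: s => [|s s' IHs IHs'|s1 s2].
  - by rewrite !tens0r !linear0 !tens0l !linear0 tmid3_0r.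
  - by rewrite !tensDr !linearD /= !tensDl !linearD /= tmid3_Dr IHs IHs'.
  by rewrite tmidE !tassocE /tmid3 tmidE tmapE /= tmidE.
have R p q : tmap idfun tensor_comul (tmid (tens p q)) =
    tmid3 (tmap idfun comul p) (tmap idfun comul q).
  elim/tensor_ind: p => [|p p' IHp IHp'|a1 a2].
  - by rewrite tens0l !linear0 tmid3_0l.
  - by rewrite tensDl !linearD /= tmid3_Dl IHp IHp'.
  elim/tensor_ind: q => [|q q' IHq IHq'|b1 b2].
  - by rewrite tens0r !linear0 tmid3_0r.
  - by rewrite tensDr !linearD /= tmid3_Dr IHq IHq'.
  by rewrite tmidE !tmapE /= tensor_comulE /tmid3 tmidE tmapE.
by rewrite L R !comulA.
Qed.

Let tmid_lift (f : A -> A -> A) (g : B -> B -> B)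
    (F : tensor A B -> tensor A B -> tensor A B) :
  bilinear_map f -> bilinear_map g -> bilinear_map F ->
  (forall a a' b b', F (tens a b) (tens a' b') = tens (f a a') (g b b')) ->
  forall p q, tlift F (tmid (tens p q)) = tens (tlift f p) (tlift g q).
Proof.
move=> bf bg bF FE p q.
elim/tensor_ind: p => [|p p' IHp IHp'|a1 a2].
- by rewrite tens0l linear0 !tlift0 // tens0l.
- by rewrite tensDl linearD /= !tliftD // tensDl IHp IHp'.
elim/tensor_ind: q => [|q q' IHq IHq'|b1 b2].
- by rewrite tens0r linear0 !tlift0 // tens0r.
- by rewrite tensDr linearD /= !tliftD // tensDr IHq IHq'.
by rewrite tmidE !tlift_tens // FE.
Qed.

Fact tensor_counitl x :
  tlift (fun x1 x2 => tensor_counit x1 *: x2) (tensor_comul x) = x.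
Proof.
have bF := bilinear_scalel (tensor A B) tensor_counit.
elim/tensor_ind: x => [|x y IHx IHy|a b]; first by rewrite linear0 tlift0.
  by rewrite linearD /= tliftD // IHx IHy.
rewrite tensor_comulE (tmid_lift (bilinear_scalel _ counit)
  (bilinear_scalel _ counit) bF) ?counitl // => a1 a2 b1 b2.
by rewrite /= tensor_counitE tensZl tensZr scalerA.
Qed.

Fact tensor_counitr x :
  tlift (fun x1 x2 => tensor_counit x2 *: x1) (tensor_comul x) = x.
Proof.
have bF := bilinear_scaler (tensor A B) tensor_counit.
elim/tensor_ind: x => [|x y IHx IHy|a b]; first by rewrite linear0 tlift0.
  by rewrite linearD /= tliftD // IHx IHy.
rewrite tensor_comulE (tmid_lift (bilinear_scaler _ counit)
  (bilinear_scaler _ counit) bF) ?counitr // => a1 a2 b1 b2.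
by rewrite /= tensor_counitE tensZl tensZr scalerA.
Qed.

Fact tensor_antipodel x :
  tlift (fun x1 x2 => tensor_antipode x1 * x2) (tensor_comul x) =
  (tensor_counit x)%:A.
Proof.
have bF := bilinear_mul tensor_antipode idfun.
elim/tensor_ind: x => [|x y IHx IHy|a b].
- by rewrite !linear0 tlift0 // scale0r.
- by rewrite !linearD /= tliftD // scalerDl IHx IHy.
rewrite tensor_comulE (tmid_lift (bilinear_mul antipode idfun)
  (bilinear_mul antipode idfun) bF) ?antipodel // => [|a1 a2 b1 b2].
  by rewrite /= tensor_counitE tensZl tensZr scalerA.
by rewrite /= tensor_antipodeE tensM.
Qed.

Fact tensor_antipoder x :
  tlift (fun x1 x2 => x1 * tensor_antipode x2) (tensor_comul x) =
  (tensor_counit x)%:A.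
Proof.
have bF := bilinear_mul idfun tensor_antipode.
elim/tensor_ind: x => [|x y IHx IHy|a b].
- by rewrite !linear0 tlift0 // scale0r.
- by rewrite !linearD /= tliftD // scalerDl IHx IHy.
rewrite tensor_comulE (tmid_lift (bilinear_mul idfun antipode)
  (bilinear_mul idfun antipode) bF) ?antipoder // => [|a1 a2 b1 b2].
  by rewrite /= tensor_counitE tensZl tensZr scalerA.
by rewrite /= tensor_antipodeE tensM.
Qed.

Definition tensor_hopf : hopfAlgType k :=
  @HopfAlg k (tensor A B) tensor_comul tensor_counit tensor_antipode
    tensor_comul_linear tensor_comul_monoid
    tensor_counit_linear tensor_counit_monoid tensor_antipode_linear
    tensor_comulA tensor_counitl tensor_counitr
    tensor_antipodel tensor_antipoder.
End TensorHopf.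

Record hopfSubalgebra (k : fieldType) (H : hopfAlgType k) := HopfSubalgebra {
  hopf_sub_pred :> {pred H};
  hopf_sub_alg : subalg_closed hopf_sub_pred;
  hopf_sub_comul : forall x, x \in hopf_sub_pred ->
    exists s : seq (H * H),
      all (fun p => (p.1 \in hopf_sub_pred) && (p.2 \in hopf_sub_pred)) s /\
      comul x = \sum_(p <- s) tens p.1 p.2;
  hopf_sub_antipode :
    forall x, x \in hopf_sub_pred -> antipode x \in hopf_sub_pred
}.

Section HopfSubalgebraType.
Variables (k : fieldType) (H : hopfAlgType k) (A : hopfSubalgebra H).

Definition hopf_sub_type : Type := {x : H | x \in A}.

HB.instance Definition _ := SubChoice.on hopf_sub_type.
HB.instance Definition _ := GRing.SubChoice_isSubAlgebra.Build k H _
  hopf_sub_type (hopf_sub_alg A).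

Definition hopf_incl : hopf_sub_type -> H := val.

Fact hopf_incl_linear : linear hopf_incl.
Proof. exact: linearP. Qed.

Fact hopf_incl_monoid : monoid_morphism hopf_incl.
Proof. by split; [exact: rmorph1 | exact: rmorphM]. Qed.

HB.instance Definition _ := GRing.isLinear.Build k hopf_sub_type H _
  hopf_incl hopf_incl_linear.
HB.instance Definition _ := GRing.isMonoidMorphism.Build hopf_sub_type H
  hopf_incl hopf_incl_monoid.

Lemma hopf_incl_inj : injective hopf_incl.
Proof. exact: val_inj. Qed.

Let iA2 : {linear tensor hopf_sub_type hopf_sub_type -> tensor H H} :=
  tmap hopf_incl hopf_incl.

Let iA2_inj : injective iA2.
Proof. by apply: tmap_inj; apply: hopf_incl_inj. Qed.

Fact sub_comul_ex (a : hopf_sub_type) :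
  exists x : tensor hopf_sub_type hopf_sub_type,
    tmap hopf_incl hopf_incl x = comul (hopf_incl a).
Proof.
have [s [sA ->]] := hopf_sub_comul (valP a).
elim: s sA => [_|p s IHs /= /andP[/andP[p1 p2] /IHs[x xE]]].
  by exists 0; rewrite big_nil linear0.
exists (tens (Sub p.1 p1 : hopf_sub_type) (Sub p.2 p2 : hopf_sub_type) + x).
by rewrite linearD /= xE tmapE big_cons.
Qed.

(* The coproduct of a lies in A (x) A, a subspace of H (x) H by tmap_inj. *)
Definition sub_comul (a : hopf_sub_type) : tensor hopf_sub_type hopf_sub_type :=
  projT1 (cid (sub_comul_ex a)).

Definition sub_counit (a : hopf_sub_type) : k := counit (hopf_incl a).

Definition sub_antipode (a : hopf_sub_type) : hopf_sub_type :=
  Sub (antipode (hopf_incl a)) (hopf_sub_antipode (valP a)).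

Lemma sub_comulE a :
  tmap hopf_incl hopf_incl (sub_comul a) = comul (hopf_incl a).
Proof. exact: projT2 (cid (sub_comul_ex a)). Qed.

Lemma sub_antipodeE a : hopf_incl (sub_antipode a) = antipode (hopf_incl a).
Proof. by []. Qed.

Fact sub_comul_linear : linear sub_comul.
Proof.
move=> c a b; apply: iA2_inj; rewrite linearP /= !sub_comulE.
by rewrite !linearP.
Qed.

Fact sub_comul_monoid : monoid_morphism sub_comul.
Proof.
split=> [|a b]; apply: iA2_inj; rewrite /= ?tmapM ?sub_comulE.
  by rewrite !rmorph1 -!tens1 tmapE !rmorph1.
by rewrite !rmorphM.
Qed.

Fact sub_counit_linear : scalar sub_counit.
Proof. by move=> c a b; rewrite /sub_counit !linearP. Qed.

Fact sub_counit_monoid : monoid_morphism sub_counit.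
Proof.
by split=> [|a b]; rewrite /sub_counit; [rewrite !rmorph1 | rewrite !rmorphM].
Qed.

Fact sub_antipode_linear : linear sub_antipode.
Proof.
move=> c a b; apply: hopf_incl_inj.
by rewrite linearP !sub_antipodeE /= !linearP.
Qed.

HB.instance Definition _ := GRing.isLinear.Build k hopf_sub_type
  (tensor hopf_sub_type hopf_sub_type) _ sub_comul sub_comul_linear.

Let tmap_sub_comul_l x :
  tmap (tmap hopf_incl hopf_incl) hopf_incl (tmap sub_comul idfun x) =
  tmap comul idfun (tmap hopf_incl hopf_incl x).
Proof.
elim/tensor_ind: x => [|x y IHx IHy|a b]; first by rewrite !linear0.
  by rewrite !linearD /= IHx IHy.
by rewrite !tmapE /= sub_comulE.
Qed.

Let tmap_sub_comul_r x :
  tmap hopf_incl (tmap hopf_incl hopf_incl) (tmap idfun sub_comul x) =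
  tmap idfun comul (tmap hopf_incl hopf_incl x).
Proof.
elim/tensor_ind: x => [|x y IHx IHy|a b]; first by rewrite !linear0.
  by rewrite !linearD /= IHx IHy.
by rewrite !tmapE /= sub_comulE.
Qed.

Let tassoc_incl x :
  tmap hopf_incl (tmap hopf_incl hopf_incl) (tassoc x) =
  tassoc (tmap (tmap hopf_incl hopf_incl) hopf_incl x).
Proof.
elim/tensor_ind: x => [|x y IHx IHy|x c]; first by rewrite !linear0.
  by rewrite !linearD /= IHx IHy.
elim/tensor_ind: x => [|x y IHx IHy|a b].
- by rewrite tens0l !linear0.
- by rewrite tensDl !linearD /= IHx IHy.
by rewrite tassocE !tmapE /= !tmapE tassocE.
Qed.

Fact sub_comulA a :
  tassoc (tmap sub_comul idfun (sub_comul a)) = tmap idfun sub_comul (sub_comul a).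
Proof.
have inj3 : injective (tmap hopf_incl (tmap hopf_incl hopf_incl)).
  by apply: tmap_inj; [exact: hopf_incl_inj | exact: iA2_inj].
apply: inj3.
by rewrite tassoc_incl tmap_sub_comul_l tmap_sub_comul_r sub_comulE comulA.
Qed.

Let sub_lift (f : hopf_sub_type -> hopf_sub_type -> hopf_sub_type)
    (F : H -> H -> H) :
  bilinear_map f -> bilinear_map F ->
  (forall a b, hopf_incl (f a b) = F (hopf_incl a) (hopf_incl b)) ->
  forall a, hopf_incl (tlift f (sub_comul a)) = tlift F (comul (hopf_incl a)).
Proof.
move=> bf bF fF a; rewrite -sub_comulE.
elim/tensor_ind: (sub_comul a) => [|x y IHx IHy|b c].
- by rewrite linear0 !tlift0 // linear0.
- by rewrite linearD /= !tliftD // linearD /= IHx IHy.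
by rewrite tmapE !tlift_tens.
Qed.

HB.instance Definition _ := GRing.isLinear.Build k hopf_sub_type k *%R
  sub_counit sub_counit_linear.
HB.instance Definition _ := GRing.isLinear.Build k hopf_sub_type hopf_sub_type _
  sub_antipode sub_antipode_linear.

Fact sub_counitl a :
  tlift (fun a1 a2 => sub_counit a1 *: a2) (sub_comul a) = a.
Proof.
apply: hopf_incl_inj.
rewrite (sub_lift (bilinear_scalel _ sub_counit) (bilinear_scalel _ counit)).
  exact: counitl.
by move=> b c; rewrite /= linearZ.
Qed.

Fact sub_counitr a :
  tlift (fun a1 a2 => sub_counit a2 *: a1) (sub_comul a) = a.
Proof.
apply: hopf_incl_inj.
rewrite (sub_lift (bilinear_scaler _ sub_counit) (bilinear_scaler _ counit)).
  exact: counitr.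
by move=> b c; rewrite /= linearZ.
Qed.

Fact sub_antipodel a :
  tlift (fun a1 a2 => sub_antipode a1 * a2) (sub_comul a) = (sub_counit a)%:A.
Proof.
apply: hopf_incl_inj.
rewrite (sub_lift (bilinear_mul sub_antipode idfun) (bilinear_mul antipode idfun)).
  by rewrite antipodel linearZ /= rmorph1.
by move=> b c; rewrite rmorphM /= sub_antipodeE.
Qed.

Fact sub_antipoder a :
  tlift (fun a1 a2 => a1 * sub_antipode a2) (sub_comul a) = (sub_counit a)%:A.
Proof.
apply: hopf_incl_inj.
rewrite (sub_lift (bilinear_mul idfun sub_antipode) (bilinear_mul idfun antipode)).
  by rewrite antipoder linearZ /= rmorph1.
by move=> b c; rewrite rmorphM /= sub_antipodeE.
Qed.

Definition sub_hopf : hopfAlgType k :=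
  @HopfAlg k hopf_sub_type sub_comul sub_counit sub_antipode
    sub_comul_linear sub_comul_monoid sub_counit_linear sub_counit_monoid
    sub_antipode_linear sub_comulA sub_counitl sub_counitr
    sub_antipodel sub_antipoder.

Lemma hopf_incl_morphism : hopf_morphism (hopf_incl : sub_hopf -> H).
Proof.
split=> [|||x|x].
- exact: hopf_incl_linear.
- exact: hopf_incl_monoid.
- by move=> x; rewrite -sub_comulE.
- by [].
- by rewrite -sub_antipodeE.
Qed.
End HopfSubalgebraType.

Definition normal_hopf_subalgebra (k : fieldType) (H : hopfAlgType k)
    (A : hopfSubalgebra H) : Prop :=
  forall h a : H, a \in A ->
    tlift (fun h1 h2 : H => h1 * a * antipode h2) (comul h) \in A /\
    tlift (fun h1 h2 : H => antipode h1 * a * h2) (comul h) \in A.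

Definition left_ideal (R : nzRingType) (I : {pred R}) : Prop :=
  [/\ 0 \in I, {in I &, forall x y, x + y \in I}
    & forall r, {in I, forall x, r * x \in I}].

(* Complete reducibility of the left regular module. *)
Definition semisimple (R : nzRingType) : Prop :=
  forall I : {pred R}, left_ideal I -> exists J : {pred R},
    [/\ left_ideal J, forall x, x \in I -> x \in J -> x = 0
      & forall x, exists u v, [/\ u \in I, v \in J & x = u + v]].

Definition in_prod_span (R : nzRingType) (A L : {pred R}) (x : R) : Prop :=
  exists s : seq (R * R),
    all (fun p => (p.1 \in A) && (p.2 \in L)) s /\
    x = \sum_(p <- s) p.1 * p.2.

Definition mul_map (k : fieldType) (H : hopfAlgType k) (A L : hopfSubalgebra H) :
    tensor_hopf (sub_hopf A) (sub_hopf L) -> H :=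
  tlift (fun (a : sub_hopf A) (l : sub_hopf L) => hopf_incl a * hopf_incl l).

Lemma mul_mapE (k : fieldType) (H : hopfAlgType k) (A L : hopfSubalgebra H)
    (a : sub_hopf A) (l : sub_hopf L) :
  mul_map (tens a l) = hopf_incl a * hopf_incl l.
Proof. by rewrite /mul_map tlift_tens //; apply: bilinear_mul. Qed.

(* Main.v *)
Require Import Defs.
From HB Require Import structures.
From mathcomp Require Import all_boot all_algebra.
From mathcomp Require Import boolp classical_sets.

Set Implicit Arguments.
Unset Strict Implicit.
Unset Printing Implicit Defensive.

Import GRing.Theory.
Local Open Scope ring_scope.

(* For a in A and l in L the commutator a1 l1 S(a2) S(l2) lies in A and in L,
   hence in k, so A and L commute and multiplication A (x) L -> H is a surjective
   morphism of Hopf algebras. For its injectivity, semisimplicity gives a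
   normalised integral t in H and, from t, a nonzero lam : H -> k with
   lam(h1) h2 = lam(h) 1. Since lam(a1 l) a2 = lam(a l1) S(l2) lies in A and in L,
   it is scalar, so lam composed with multiplication is again an integral, on
   A (x) L. A nonzero integral is nondegenerate: a right ideal on which it
   vanishes is 0. The kernel of multiplication is such an ideal. *)

(** * Linear algebra: dual families and shortest tensor expressions *)

Section LinearIndependence.
Variable k : fieldType.

Definition independent (V : lmodType k) n (u : 'I_n -> V) : Prop :=
  forall c : 'I_n -> k, \sum_i c i *: u i = 0 -> forall i, c i = 0.

Lemma scalar_linear (V : lmodType k) (f : V -> k) : scalar f ->
  exists g : {linear V -> k | *%R}, forall v, g v = f v.
Proof.
by move=> f_lin; exists (HB.pack_for {linear V -> k | *%R} f
  (GRing.isLinear.Build _ _ _ _ f f_lin)).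
Qed.

(** Independence makes [x |-> \sum_i x_i u_i] injective on row vectors; the coordinates of a linear
    retraction of it are the dual functionals. [V] may be infinite-dimensional. *)
Lemma dual_family (V : lmodType k) n (u : 'I_n -> V) : independent u ->
  exists r : 'I_n -> {linear V -> k | *%R}, forall i j, r i (u j) = (i == j)%:R.
Proof.
move=> u_indep; pose f (x : 'rV[k]_n) := \sum_i x 0 i *: u i.
have f_lin : linear f.
  move=> c x y; rewrite /f scaler_sumr -big_split; apply: eq_bigr => i _ /=.
  by rewrite !mxE scalerDl scalerA.
pose F := HB.pack f (GRing.isLinear.Build _ _ _ _ f f_lin) : {linear 'rV[k]_n -> V}.
have F_inj : injective F.
  move=> x y /eqP; rewrite -subr_eq0 -linearB => /eqP Fxy.
  apply/rowP => i; apply/eqP; rewrite -subr_eq0; apply/eqP.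
  by have := u_indep _ Fxy i; rewrite !mxE.
have [q qK] := linear_retract F_inj.
have coord i : exists g : {linear V -> k | *%R}, forall v, g v = q v 0 i.
  by apply: scalar_linear => c v w; rewrite linearP !mxE.
have [r rE] := choice coord; exists r => i j; rewrite rE.
suff -> : u j = F (delta_mx 0 j) by rewrite qK mxE eqxx eq_sym.
rewrite /= /f (bigD1 j) //= big1 => [|i' /negPf i'j]; rewrite mxE eqxx.
  by rewrite eqxx scale1r addr0.
by rewrite i'j scale0r.
Qed.

(** Writing the [u i] in terms of the [v j] gives a square matrix whose rows are independent, so it
    is invertible and the [v j] are combinations of the [u i]. *)
Lemma independent_span (V : lmodType k) n (u v : 'I_n -> V) :
    independent u -> (forall x, exists c : 'I_n -> k, x = \sum_i c i *: v i) ->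
  forall x, exists c : 'I_n -> k, x = \sum_i c i *: u i.
Proof.
move=> u_indep v_span; have [m mE] := choice (fun i => v_span (u i)).
pose M := \matrix_(i, j) m i j.
have uE (c : 'rV[k]_n) : \sum_i c 0 i *: u i = \sum_j (c *m M) 0 j *: v j.
  under eq_bigr do rewrite mE scaler_sumr.
  rewrite exchange_big; apply: eq_bigr => j _; rewrite mxE scaler_suml.
  by apply: eq_bigr => i _; rewrite mxE scalerA.
have M_unit : M \in unitmx.
  rewrite -row_free_unit; apply/row_freeP.
  apply: contrapT => nM; have: ~~ row_free M by apply/row_freeP.
  rewrite -kermx_eq0 => /rowV0Pn[c /sub_kermxP cM0 /eqP[]].
  apply/rowP => i; rewrite mxE; apply: u_indep i.
  by rewrite uE cM0 big1 // => j _; rewrite mxE scale0r.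
move=> x; have [c ->] := v_span x.
pose d := (\row_i c i) *m invmx M; exists (d 0).
by rewrite uE (mulmxKV M_unit); apply/esym/eq_bigr => j _; rewrite mxE.
Qed.

(** A dependency expresses one [u i0] through the others, and [v i0] is then absorbed into the
    remaining [v i]. Allowing any bilinear [f] lets the same lemma treat the second factors, by
    flipping the arguments of [tens]. *)
Lemma dependent_shorten (V W U : lmodType k) (f : V -> W -> U) n
    (u : 'I_n.+1 -> V) (v : 'I_n.+1 -> W) :
  bilinear_map f -> ~ independent u ->
  exists (u' : 'I_n -> V) (v' : 'I_n -> W),
    \sum_i f (u i) (v i) = \sum_i f (u' i) (v' i).
Proof.
move=> [fl fr] /existsNP[c /not_implyP[cu0 /existsNP[i0 /eqP ci0]]].
(* Coefficients of [u i0] on the other vectors, from solving the dependency. *)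
pose d i := - (c i0)^-1 * c (lift i0 i).
have ui0 : u i0 = \sum_i d i *: u (lift i0 i).
  apply: (scalerI ci0); move: cu0; rewrite (bigD1_ord i0) //= => /eqP.
  rewrite addr_eq0 => /eqP ->; rewrite scaler_sumr -sumrN.
  by apply: eq_bigr => i _; rewrite scalerA mulrA mulrN mulfV // mulN1r scaleNr.
exists (fun i => u (lift i0 i)), (fun i => v (lift i0 i) + d i *: v i0).
have fsum (I : finType) (x : I -> V) w : f (\sum_i x i) w = \sum_i f (x i) w.
  apply: (big_morph (f^~ w)) => [a b|]; last exact: bilinear_map0l.
  by have := fl w 1 a b; rewrite !scale1r.
rewrite (bigD1_ord i0) //= ui0 fsum -big_split /=; apply: eq_bigr => i _.
have -> : v (lift i0 i) + d i *: v i0 = d i *: v i0 + v (lift i0 i) by rewrite addrC.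
by rewrite fr (bilinear_mapZl _ _ _ (conj fl fr)).
Qed.

(** In an expression of least length both families are independent, since a dependency on either
    side would shorten it. *)
Lemma tensor_independent (V W : lmodType k) (x : tensor V W) :
  exists n (u : 'I_n -> V) (v : 'I_n -> W),
    [/\ x = \sum_i tens (u i) (v i), independent u & independent v].
Proof.
pose P n := `[< exists (u : 'I_n -> V) (v : 'I_n -> W), x = \sum_i tens (u i) (v i) >].
have exP : exists n, P n.
  have [s xE] := tensor_sumE x; exists (size s); apply/asboolP.
  exists (fun i => (tnth (in_tuple s) i).1), (fun i => (tnth (in_tuple s) i).2).
  by rewrite xE (big_tnth _ _ s).
case: (ex_minnP exP) => -[|n] /asboolP[u [v xE]] minP.
  by exists 0, u, v; split=> // c _ [].
have notP : ~ P n by move=> /minP; rewrite ltnn.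
have [tl tr] := tens_bilinear V W.
exists n.+1, u, v; split=> //; apply: contrapT => dep; apply: notP; apply/asboolP.
  have [u' [v' uv]] := dependent_shorten v (tens_bilinear V W) dep.
  by exists u', v'; rewrite xE.
have [v' [u' uv]] :=
  dependent_shorten u (conj tr tl : bilinear_map (fun w v => tens v w)) dep.
by exists u', v'; rewrite xE.
Qed.
End LinearIndependence.

(** * Calculus of Sweedler sums *)

Section TensorLift.
Variable k : fieldType.

(** [tlift] sums over a fixed representative, so identities that keep the tensor fixed are
    identities of finite sums; where the tensor is rewritten, bilinearity gives independence of the
    representative. *)
Lemma eq_tlift (V W U : lmodType k) (f g : V -> W -> U) x :
  (forall v w, f v w = g v w) -> tlift f x = tlift g x.
Proof. by move=> fg; apply: eq_bigr => p _; apply: fg. Qed.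

Lemma linear_tlift (V W U U' : lmodType k) (g : {linear U -> U'})
    (f : V -> W -> U) x :
  g (tlift f x) = tlift (fun v w => g (f v w)) x.
Proof. exact: linear_sum. Qed.

Lemma tlift_exchange (V W V' W' U : lmodType k) (F : V -> W -> V' -> W' -> U) x y :
  tlift (fun v w => tlift (F v w) y) x =
  tlift (fun v' w' => tlift (fun v w => F v w v' w') x) y.
Proof. exact: exchange_big. Qed.

Lemma tlift_mull (V W : lmodType k) (R : algType k) (f : V -> W -> R) r x :
  r * tlift f x = tlift (fun v w => r * f v w) x.
Proof. exact: mulr_sumr. Qed.

Lemma tlift_mulr (V W : lmodType k) (R : algType k) (f : V -> W -> R) r x :
  tlift f x * r = tlift (fun v w => f v w * r) x.
Proof. exact: mulr_suml. Qed.

Lemma tlift_scaler (V W U : lmodType k) (f : V -> W -> U) c x :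
  c *: tlift f x = tlift (fun v w => c *: f v w) x.
Proof. exact: scaler_sumr. Qed.

Lemma tlift_sum_tens (V W U : lmodType k) (f : V -> W -> U) (I : Type) (s : seq I)
    (v : I -> V) (w : I -> W) : bilinear_map f ->
  tlift f (\sum_(i <- s) tens (v i) (w i)) = \sum_(i <- s) f (v i) (w i).
Proof.
move=> bf; elim: s => [|i s IHs]; first by rewrite !big_nil tlift0.
by rewrite !big_cons tliftD // tlift_tens // IHs.
Qed.

Lemma tliftZ (V W U : lmodType k) (f : V -> W -> U) c x : bilinear_map f ->
  tlift f (c *: x) = c *: tlift f x.
Proof.
by move=> bf; rewrite -[c *: x]addr0 (tlift_linear bf) tlift0 // addr0.
Qed.

Lemma tlift_bilinearl (V W V' W' U : lmodType k) (f : V' -> W' -> U)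
    (g : V -> W -> V') x w' : bilinear_map f ->
  f (tlift g x) w' = tlift (fun v w => f (g v w) w') x.
Proof.
move=> bf; apply: (big_morph (f^~ w')) => [a b|]; last exact: bilinear_map0l.
by have [fl _] := bf; have := fl w' 1 a b; rewrite !scale1r.
Qed.

Lemma bilinear_flip (V W U : lmodType k) (f : V -> W -> U) :
  bilinear_map f -> bilinear_map (fun w v => f v w).
Proof. by case. Qed.

Lemma tlift_tlift (V W V' W' U : lmodType k) (f : V' -> W' -> U)
    (g : V -> W -> tensor V' W') x : bilinear_map f ->
  tlift f (tlift g x) = tlift (fun v w => tlift f (g v w)) x.
Proof.
move=> bf; pose F : {linear tensor V' W' -> U} :=
  HB.pack (tlift f) (GRing.isLinear.Build _ _ _ _ (tlift f) (tlift_linear bf)).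
exact: (linear_tlift F).
Qed.

Lemma tlift_tmap (V V' W W' U : lmodType k) (f : V -> V') (g : W -> W')
    (F : V' -> W' -> U) x : bilinear_map F ->
  tlift F (tmap f g x) = tlift (fun v w => F (f v) (g w)) x.
Proof.
by move=> bF; rewrite tlift_tlift //; apply: eq_tlift => v w; rewrite tlift_tens.
Qed.

Lemma tlift_mul (A B : algType k) (U : lmodType k) (f : A -> B -> U)
    (x y : tensor A B) : bilinear_map f ->
  tlift f (x * y) =
  tlift (fun a b => tlift (fun c d => f (a * c) (b * d)) y) x.
Proof.
move=> bf; rewrite [x * y]/(tensor_mul x y) tlift_tlift //.
apply: eq_tlift => a b; rewrite tlift_tlift //.
by apply: eq_tlift => c d; rewrite tlift_tens.
Qed.
End TensorLift.

(** * Coassociativity and counit in Sweedler form *)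

Section Sweedler.
Variables (k : fieldType) (H : hopfAlgType k).

Definition trilinear_map (U : lmodType k) (F : H -> H -> H -> U) : Prop :=
  (forall x, bilinear_map (F x)) /\ (forall y z, linear (fun x => F x y z)).

Lemma tlift_comulA (U : lmodType k) (F : H -> H -> H -> U) h :
  trilinear_map F ->
  tlift (fun x z => tlift (fun x y => F x y z) (comul x)) (comul h) =
  tlift (fun x y => tlift (F x) (comul y)) (comul h).
Proof.
case=> bF lF.
have bF' z : bilinear_map (fun x y => F x y z).
  by split=> [y|x] c a b; [apply: lF | have [Fl _] := bF x; apply: Fl].
have bL : bilinear_map (fun (x : tensor H H) z => tlift (fun a b => F a b z) x).
  split=> [z|x] c a b; first exact: tlift_linear.
  by apply: tlift_param => v w; have [_ Fr] := bF v; apply: Fr.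
have bR : bilinear_map (fun x (y : tensor H H) => tlift (F x) y).
  split=> [y|x] c a b; last exact: tlift_linear.
  by apply: tlift_param => v w; apply: lF.
(* Regrouping is checked on pure tensors for arbitrary [z], then used at the left iterated
   coproduct, which [comulA] carries to the right one. *)
have assoc z : tlift (fun x z => tlift (fun a b => F a b z) x) z =
    tlift (fun x y => tlift (F x) y) (tassoc z).
  elim/tensor_ind: z => [|x y IHx IHy|x z].
  - by rewrite linear0 !tlift0.
  - by rewrite linearD /= !tliftD // IHx IHy.
  rewrite tlift_tens //; elim/tensor_ind: x => [|x y IHx IHy|x y].
  - by rewrite tens0l linear0 !tlift0.
  - by rewrite tensDl linearD /= !tliftD // IHx IHy.
  by rewrite tassocE !tlift_tens.
have := assoc (tmap comul idfun (comul h)); rewrite comulA.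
by rewrite !tlift_tmap.
Qed.

Lemma tlift_counitl (U : lmodType k) (f : H -> U) h : linear f ->
  tlift (fun x y => counit x *: f y) (comul h) = f h.
Proof.
move=> f_lin; pose F : {linear H -> U} :=
  HB.pack f (GRing.isLinear.Build _ _ _ _ f f_lin).
rewrite -[f]/(F : H -> U) -[in RHS](counitl h) linear_tlift.
by apply: eq_tlift => x y; rewrite linearZ.
Qed.

Lemma tlift_counitr (U : lmodType k) (f : H -> U) h : linear f ->
  tlift (fun x y => counit y *: f x) (comul h) = f h.
Proof.
move=> f_lin; pose F : {linear H -> U} :=
  HB.pack f (GRing.isLinear.Build _ _ _ _ f f_lin).
rewrite -[f]/(F : H -> U) -[in RHS](counitr h) linear_tlift.
by apply: eq_tlift => x y; rewrite linearZ.
Qed.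

(** Apply the counit to [S(h1) h2 = counit(h) 1]. *)
Lemma counit_antipode (h : H) : counit (antipode h) = counit h.
Proof.
rewrite -[in LHS](counitr h).
have -> : counit h = counit ((counit h)%:A : H) by rewrite linearZ /= rmorph1 mulr1.
rewrite -antipodel.
rewrite /tlift /eval_sum !linear_sum; apply: eq_bigr => p _.
by rewrite /= !linearZ /= rmorphM mulrC.
Qed.

(** * Integrals on [H] and their nondegeneracy *)

Definition integral (lam : {linear H -> k | *%R}) : Prop :=
  forall h, tlift (fun x y => lam x *: y) (comul h) = (lam h)%:A.

(** [lam(x1 y) x2 = lam(x1 y1) x2 y2 S(y3) = lam(x y1) S(y2)], the last step being the integral
    property at [x y1]. This trades the coproduct of [x] for that of [y]. *)
Lemma integral_antipode (lam : {linear H -> k | *%R}) x y : integral lam ->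
  tlift (fun x1 x2 => lam (x1 * y) *: x2) (comul x) =
  tlift (fun y1 y2 => lam (x * y1) *: antipode y2) (comul y).
Proof.
move=> lam_int; have b_lam := bilinear_scalel H lam.
transitivity (tlift (fun x1 x2 => tlift (fun y1 y2 =>
   lam (x1 * y1) *: (x2 * (counit y2)%:A)) (comul y)) (comul x)).
  apply: eq_tlift => x1 x2.
  rewrite -(@tlift_counitr _ (fun y => lam (x1 * y) *: x2)); last first.
    by move=> c a b; rewrite mulrDr -scalerAr linearP scalerDl scalerA.
  by apply: eq_tlift => y1 y2; rewrite -scalerAr mulr1 scalerA mulrC scalerA.
transitivity (tlift (fun x1 x2 => tlift (fun y1 y2 =>
   tlift (fun y2 y3 => lam (x1 * y1) *: (x2 * (y2 * antipode y3))) (comul y2))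
   (comul y)) (comul x)).
  apply: eq_tlift => x1 x2; apply: eq_tlift => y1 y2.
  by rewrite -antipoder tlift_mull tlift_scaler.
transitivity (tlift (fun x1 x2 => tlift (fun y1 y3 =>
   tlift (fun y1 y2 => lam (x1 * y1) *: (x2 * (y2 * antipode y3))) (comul y1))
   (comul y)) (comul x)).
  apply: eq_tlift => x1 x2; rewrite tlift_comulA //.
  split=> [y1|y2 y3]; last first.
    by move=> c a b; rewrite mulrDr -scalerAr linearP scalerDl scalerA.
  split=> [y3|y2] c a b.
    by rewrite mulrDl mulrDr -!(scalerAl, scalerAr) scalerDr !scalerA mulrC.
  by rewrite linearP !mulrDr -!scalerAr scalerDr !scalerA mulrC.
rewrite tlift_exchange; apply: eq_tlift => y1 y3.
have -> : lam (x * y1) *: antipode y3 = (lam (x * y1))%:A * antipode y3.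
  by rewrite -scalerAl mul1r.
rewrite -lam_int rmorphM tlift_mul // tlift_mulr.
apply: eq_tlift => x1 x2; rewrite tlift_mulr; apply: eq_tlift => a b.
by rewrite -scalerAl mulrA.
Qed.


(** Let [N] be the set of [x] with [lam(x H) = 0]. Then [comul] maps [N] into [N (x) H] and the
    counit vanishes on [N], so [x = counit(x1) x2 = 0] for [x] in [N]. *)
Lemma integral_nondegenerate (lam : {linear H -> k | *%R}) x :
    integral lam -> (exists y, lam y != 0) ->
  (forall y, lam (x * y) = 0) -> x = 0.
Proof.
move=> lam_int [y0 y0_neq0].
have b_lam := bilinear_scalel H lam.
(* By [integral_antipode], [lam(x1 y) x2 = lam(x y1) S(y2) = 0]; as the [q i] are independent, every
   [p i] lies in [N]. *)
have split_x x0 : (forall y, lam (x0 * y) = 0) -> exists n (p q : 'I_n -> H),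
    comul x0 = \sum_i tens (p i) (q i) /\ (forall i y, lam (p i * y) = 0).
  move=> x0_0; have [n [p [q [x0E _ q_indep]]]] := tensor_independent (comul x0).
  exists n, p, q; split=> // i y; apply: (q_indep (fun i => lam (p i * y))).
  have := integral_antipode x0 y lam_int; rewrite x0E.
  rewrite tlift_sum_tens => [->|]; last first.
    split=> [w|v] c a b; first by rewrite mulrDl -scalerAl linearP scalerDl scalerA.
    by rewrite scalerDr !scalerA mulrC.
  rewrite /tlift /eval_sum big1 // => r _.
  by rewrite x0_0 scale0r.
(* [counit(x) lam(y0) = lam(x1 S(x2) y0)], where each [x1] may be taken in [N]. *)
have counit0 x0 : (forall y, lam (x0 * y) = 0) -> counit x0 = 0.
  move=> /split_x[n [p [q [x0E p0]]]]; apply: (mulIf y0_neq0); rewrite mul0r.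
  have <- : lam ((counit x0)%:A * y0) = counit x0 * lam y0.
    by rewrite -scalerAl mul1r linearZ.
  rewrite -antipoder x0E tlift_sum_tens; last first.
    exact: (bilinear_mul (idfun : {linear H -> H}) (antipode : {linear H -> H})).
  rewrite mulr_suml linear_sum big1 // => i _.
  by rewrite -mulrA p0.
move=> /split_x[n [p [q [xE p0]]]]; rewrite -(counitl x) xE.
rewrite tlift_sum_tens; last exact: bilinear_scalel.
by rewrite big1 // => i _; rewrite counit0 ?scale0r.
Qed.

(** * Integrals obtained from semisimplicity *)

Definition left_integral (t : H) : Prop := forall h, h * t = counit h *: t.

(** Take a left ideal complement [J] of the augmentation ideal and let [t] be the component of [1]
    in [J]: then [h t - counit(h) t] lies in both ideals. *)
Lemma semisimple_left_integral : semisimple H ->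
  exists2 t : H, left_integral t & counit t = 1.
Proof.
move=> ssH; pose K := [pred h : H | counit h == 0].
have idK : left_ideal K.
  split=> [|x y|r x]; rewrite !inE ?linear0 //.
    by move=> /eqP x0 /eqP y0; rewrite linearD /= x0 y0 addr0.
  by move=> /eqP x0; rewrite rmorphM /= x0 mulr0.
have [J [[_ JD JM] KJ KJsum]] := ssH K idK.
have [u [t [/eqP u0 tJ tE]]] := KJsum 1.
have t1 : counit t = 1.
  by have := linearD (@counit k H) u t; rewrite /= u0 add0r -[u + t]tE rmorph1 => <-.
exists t => // h; apply/eqP; rewrite -subr_eq0; apply/eqP; apply: KJ.
  by rewrite inE linearB /= linearZ /= rmorphM /= subrr.
have -> : h * t - counit h *: t = (h - (counit h)%:A) * t.
  by rewrite mulrBl -scalerAl mul1r.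
exact: JM.
Qed.

(* S(h) t1 (x) t2 = S(h1) h2 t1 (x) h3 t2 = t1 (x) h t2 *)
Lemma left_integral_antipode (U : lmodType k) (f : H -> H -> U) t h :
  left_integral t -> bilinear_map f ->
  tlift (fun t1 t2 => f (antipode h * t1) t2) (comul t) =
  tlift (fun t1 t2 => f t1 (h * t2)) (comul t).
Proof.
move=> t_int bf; have [fl fr] := bf.
transitivity (tlift (fun h1 h2 => tlift (fun t1 t2 =>
    f (antipode h1 * t1) t2) (comul (h2 * t))) (comul h)).
  rewrite -(@tlift_counitr _ (fun h => tlift
    (fun t1 t2 => f (antipode h * t1) t2) (comul t))); last first.
    move=> c a b; apply: tlift_param => v w.
    by rewrite linearP mulrDl -scalerAl fl.
  apply: eq_tlift => h1 h2; rewrite t_int linearZ /= tliftZ //.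
  by split=> [w|v] c a b; rewrite ?mulrDr -?scalerAr ?fl ?fr.
transitivity (tlift (fun x y => tlift (fun h2 h3 => tlift (fun t1 t2 =>
    f (antipode x * (h2 * t1)) (h3 * t2)) (comul t)) (comul y)) (comul h)).
  apply: eq_tlift => x y; rewrite rmorphM tlift_mul //.
  by split=> [w|v] c a b; rewrite ?mulrDr -?scalerAr ?fl ?fr.
rewrite -tlift_comulA; last first.
  split=> [x|y z c a b]; last first.
    by apply: tlift_param => v w; rewrite linearP mulrDl -scalerAl fl.
  split=> [y|y] c a b; apply: tlift_param => v w.
    by rewrite mulrDl -scalerAl mulrDr -scalerAr fl.
  by rewrite mulrDl -scalerAl fr.
rewrite -(@tlift_counitl _ (fun h => tlift
    (fun t1 t2 => f t1 (h * t2)) (comul t))); last first.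
  move=> c a b; apply: tlift_param => v w.
  by rewrite mulrDl -scalerAl fr.
apply: eq_tlift => x h3; rewrite tlift_exchange tlift_scaler.
apply: eq_tlift => t1 t2.
rewrite -(bilinear_mapZl _ _ _ bf) -[counit x *: t1]mulr_algl -antipodel.
rewrite tlift_mulr tlift_bilinearl //; apply: eq_tlift => h1 h2.
by rewrite mulrA.
Qed.

(** With [comul t] the sum of the [u_i (x) v_i], both families independent, [lam x] is the sum of
    the [u_j^*(S^2(u_j) x)]. Both families turn out to be bases of [H], so [lam x] is the trace of
    [y |-> S^2(y) x]. The integral property is verified on the [u_i]. *)
Lemma integral_exists : semisimple H ->
  exists lam : {linear H -> k | *%R}, integral lam /\ exists y, lam y != 0.
Proof.
move=> /semisimple_left_integral[t t_int t1].
have [n [u [v [tE u_indep v_indep]]]] := tensor_independent (comul t).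
have [r rE] := dual_family u_indep.
(* With u_j^* = r j: 1 = S(t1) t2 = S(u_j) v_j = u_j^*(t1) S(u_j) t2
   = u_j^*(S^2(u_j) t1) t2, which is lam(t1) t2. *)
have [lam lamE] : exists lam : {linear H -> k | *%R},
    forall x, lam x = \sum_j r j (antipode (antipode (u j)) * x).
  apply: scalar_linear => c x y; rewrite mulr_sumr -big_split.
  by apply: eq_bigr => j _ /=; rewrite mulrDr -scalerAr linearP.
have rt j : tlift (fun x y => r j x *: y) (comul t) = v j.
  rewrite tE tlift_sum_tens; last exact: bilinear_scalel.
  rewrite (bigD1 j) //= big1 => [|i /negPf ij]; rewrite rE.
    by rewrite eqxx scale1r addr0.
  by rewrite eq_sym ij scale0r.
have lam_t : tlift (fun x y => lam x *: y) (comul t) = 1.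
  transitivity (\sum_j antipode (u j) * v j); last first.
    rewrite -[RHS]scale1r -t1 -antipodel tE tlift_sum_tens //.
    exact: (bilinear_mul (antipode : {linear H -> H}) (idfun : {linear H -> H})).
  under [RHS]eq_bigr => j _.
    rewrite -rt tlift_mull.
    under eq_tlift do rewrite -scalerAr.
    rewrite -(left_integral_antipode _ t_int (bilinear_scalel _ _)).
    over.
  rewrite exchange_big; apply: eq_bigr => p _ /=.
  by rewrite lamE scaler_suml.
(* [h = lam(t1) h t2 = lam(S(h) t1) t2], a combination of the [v i]. This is where [H] is seen to be
   finite-dimensional. *)
have v_span h : exists c : 'I_n -> k, h = \sum_i c i *: v i.
  exists (fun i => lam (antipode h * u i)).
  rewrite -[LHS]mulr1 -lam_t tlift_mull.
  under eq_tlift do rewrite -scalerAr.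
  rewrite -(left_integral_antipode _ t_int (bilinear_scalel _ _)).
  rewrite tE tlift_sum_tens //.
  split=> [w|x] c a b; first by rewrite mulrDr -scalerAr linearP scalerDl scalerA.
  by rewrite scalerDr !scalerA mulrC.
have u_span := independent_span u_indep v_span.
exists lam; split; last first.
  apply: contrapT => /forallNP lam0; have /eqP := lam_t.
  rewrite /tlift /eval_sum big1 => [|p _]; first by rewrite eq_sym oner_eq0.
  by have /negP/negbNE/eqP -> := lam0 p.1; rewrite scale0r.
have b_lam := bilinear_scalel H lam.
(* The defect of the integral property. Once [s(t2) Phi(t1) = 0] for all functionals [s], taking [s]
   dual to the [v i] gives [Phi (u i) = 0], and the [u i] span [H]. *)
pose Phi x := tlift (fun x y => lam x *: y) (comul x) - (lam x)%:A.
have Phi_lin : linear Phi.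
  move=> c x y; rewrite /Phi !linearP /= (tlift_linear b_lam).
  by rewrite scalerDl scalerBr -scalerA opprD addrACA.
have Phi_t (s : {linear H -> k | *%R}) :
    tlift (fun x y => s y *: Phi x) (comul t) = 0.
  transitivity (tlift (fun x y =>
      s y *: tlift (fun x y => lam x *: y) (comul x)) (comul t)
      - tlift (fun x y => s y *: (lam x)%:A) (comul t)).
    by rewrite -sumrB; apply: eq_bigr => p _; apply: scalerBr.
  apply/eqP; rewrite subr_eq0; apply/eqP.
  (* Applying [comul] to [lam(t1) t2 = 1] gives [lam(t1) t2 (x) t3 = 1 (x) 1], hence the first term;
     applying [s] to it gives the second. *)
  transitivity (s 1 *: (1 : H)).
    under eq_tlift do rewrite tlift_scaler.
    rewrite tlift_comulA; last first.
      split=> [x|y z c a b]; last first.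
        by rewrite linearP scalerDl scalerDr !scalerA mulrCA mulrA.
      split=> [y|y] c a b.
        by rewrite !scalerDr !scalerA mulrC -!mulrA [c * _]mulrC.
      by rewrite linearP scalerDl !scalerA.
    transitivity (tlift (fun b c => s c *: b) (comul 1 : tensor H H)).
      rewrite -lam_t linear_tlift tlift_tlift; last exact: bilinear_scaler.
      apply: eq_tlift => x y; rewrite linearZ /= tliftZ; last exact: bilinear_scaler.
      by rewrite tlift_scaler; apply: eq_tlift => b c; rewrite !scalerA mulrC.
    by rewrite rmorph1 -tens1 tlift_tens //; exact: bilinear_scaler.
  rewrite -[in s 1]lam_t /tlift /eval_sum linear_sum scaler_suml; apply: eq_bigr => p _.
  by rewrite linearZ /= !scalerA mulrC.
have [q qE] := dual_family v_indep.
have Phi_u i : Phi (u i) = 0.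
  rewrite -(Phi_t (q i)) tE tlift_sum_tens; last first.
    split=> [y|x] c a b; last by rewrite linearP scalerDl scalerA.
    by rewrite Phi_lin scalerDr !scalerA mulrC.
  rewrite (bigD1 i) //= big1 => [|j /negPf ji]; rewrite qE.
    by rewrite eqxx scale1r addr0.
  by rewrite eq_sym ji scale0r.
move=> h; apply/eqP; rewrite -subr_eq0 -/(Phi h); have [c ->] := u_span h.
pose F : {linear H -> H} := HB.pack Phi (GRing.isLinear.Build _ _ _ _ Phi Phi_lin).
rewrite -[Phi]/(F : H -> H) linear_sum big1 // => i _.
by rewrite linearZ /= Phi_u scaler0.
Qed.
End Sweedler.

(** * Bialgebra morphisms preserve antipodes *)

(* Both sides are convolution inverses of F. *)
Lemma bialgebra_morphism_antipode (k : fieldType) (G H : hopfAlgType k)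
    (F : {lrmorphism G -> H}) x :
  (forall x, comul (F x) = tmap F F (comul x)) ->
  (forall x, counit (F x) = counit x) -> antipode (F x) = F (antipode x).
Proof.
move=> F_comul F_counit.
have SF_lin : linear (fun x => antipode (F x)) by move=> c a b; rewrite !linearP.
have FS_lin : linear (fun x => F (antipode x)) by move=> c a b; rewrite !linearP.
rewrite -[LHS](tlift_counitr x SF_lin) -[RHS](tlift_counitl x FS_lin).
transitivity (tlift (fun x y => tlift (fun y z =>
    antipode (F x) * F y * F (antipode z)) (comul y)) (comul x)).
  apply: eq_tlift => a b.
  rewrite -[_ *: _]mulr_algr -(rmorph1 F) -linearZ /= -antipoder linear_tlift.
  by rewrite tlift_mull; apply: eq_tlift => c d; rewrite rmorphM mulrA.
rewrite -tlift_comulA; last first.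
  split=> [a|b c e v w]; last by rewrite SF_lin !mulrDl -!scalerAl.
  split=> [b|b] c v w; first by rewrite linearP mulrDr mulrDl -scalerAr -scalerAl.
  by rewrite FS_lin mulrDr -scalerAr.
apply: eq_tlift => a b; rewrite -[_ *: _]mulr_algl -F_counit -antipodel F_comul.
rewrite tlift_tmap; last first.
  exact: (bilinear_mul (antipode : {linear H -> H}) (idfun : {linear H -> H})).
by rewrite tlift_mulr.
Qed.

Lemma bialgebra_morphism_hopf (k : fieldType) (G H : hopfAlgType k) (f : G -> H) :
  linear f -> monoid_morphism f ->
  (forall x, comul (f x) = tmap f f (comul x)) ->
  (forall x, counit (f x) = counit x) -> hopf_morphism f.
Proof.
move=> f_lin f_mor f_comul f_counit; split=> // x.
pose F : {lrmorphism G -> H} := HB.pack f (GRing.isLinear.Build _ _ _ _ f f_lin)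
  (GRing.isMonoidMorphism.Build _ _ f f_mor).
exact: (@bialgebra_morphism_antipode _ _ _ F).
Qed.

Lemma inj_surj_bijective (T U : Type) (f : T -> U) :
  injective f -> (forall y, exists x, y = f x) -> bijective f.
Proof.
move=> f_inj f_surj; have [g gE] := choice f_surj.
by exists g => [x|y]; [apply: f_inj; rewrite -gE | rewrite -gE].
Qed.

(** * Sweedler sums over a Hopf subalgebra *)

Section Subalgebra.
Variables (k : fieldType) (H : hopfAlgType k) (A : hopfSubalgebra H).

Lemma hopf_sub_sum (I : Type) (s : seq I) (f : I -> H) (P : pred I) :
  (forall i, P i -> f i \in A) -> all P s -> \sum_(i <- s) f i \in A.
Proof.
have [A1 AD _] := hopf_sub_alg A.
move=> fA; elim: s => [_|i s IHs /= /andP[Pi /IHs sA]].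
  by rewrite big_nil -(addNr 1) -scaleN1r; apply: AD.
by rewrite big_cons -[f i]scale1r; apply: AD => //; apply: fA.
Qed.

Lemma hopf_sub_mul x y : x \in A -> y \in A -> x * y \in A.
Proof. by have [_ _ AM] := hopf_sub_alg A; apply: AM. Qed.

Lemma eq_tlift_sub (U : lmodType k) (f g : H -> H -> U) x : x \in A ->
  bilinear_map f -> bilinear_map g ->
  (forall y z, y \in A -> z \in A -> f y z = g y z) ->
  tlift f (comul x) = tlift g (comul x).
Proof.
move=> /hopf_sub_comul[s [sA ->]] bf bg fg; rewrite !tlift_sum_tens //.
elim: s sA => [|p s IHs /= /andP[/andP[p1 p2] /IHs sE]]; first by rewrite !big_nil.
by rewrite !big_cons sE fg.
Qed.

(** [f(x) = f(x1) S(x2) x3 = z counit(x1) x2 = z x]. This cancels the antipode on the right of an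
    adjoint-type identity. *)
Lemma adjoint_mul (f : H -> H) (z : H) : linear f ->
  (forall x, x \in A ->
    tlift (fun x1 x2 => f x1 * antipode x2) (comul x) = counit x *: z) ->
  forall x, x \in A -> f x = z * x.
Proof.
move=> f_lin f_ad x xA; rewrite -[LHS](tlift_counitr x f_lin).
have z_lin : linear ( *%R z) by move=> c a b; rewrite mulrDr -scalerAr.
rewrite -[RHS](tlift_counitl x z_lin).
transitivity (tlift (fun x y => tlift (fun y1 y2 =>
    f x * antipode y1 * y2) (comul y)) (comul x)).
  apply: eq_tlift => a b; rewrite -[_ *: _]mulr_algr -antipodel tlift_mull.
  by apply: eq_tlift => c d; rewrite mulrA.
rewrite -tlift_comulA; last first.
  split=> [a|b c e v w]; last by rewrite f_lin !mulrDl -!scalerAl.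
  split=> [b|b] c v w; last by rewrite mulrDr -scalerAr.
  by rewrite linearP mulrDr mulrDl -scalerAr -scalerAl.
have b_fS : bilinear_map (fun x1 x2 => f x1 * antipode x2).
  by split=> [w|v] c a b; rewrite ?linearP ?f_lin ?mulrDl ?mulrDr -?scalerAl -?scalerAr.
under eq_tlift do rewrite -tlift_mulr.
apply: eq_tlift_sub => // [||a b aA bA].
- split=> [w|v] c a b; last by rewrite mulrDr -scalerAr.
  by rewrite linearP (tlift_linear b_fS) mulrDl -scalerAl.
- split=> [w|v] c a b; first by rewrite linearP scalerDl scalerA.
  by rewrite mulrDr -scalerAr scalerDr !scalerA mulrC.
by rewrite f_ad // -scalerAl.
Qed.
End Subalgebra.

(** * Consequences of normality and trivial intersection *)

Section Factorization.
Variables (k : fieldType) (H : hopfAlgType k) (A L : hopfSubalgebra H).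
Hypotheses (nA : normal_hopf_subalgebra A) (nL : normal_hopf_subalgebra L).
Hypothesis capAL : forall h : H, h \in A -> h \in L -> exists c : k, h = c%:A.

Lemma cap_scalar h : h \in A -> h \in L -> h = (counit h)%:A.
Proof. by move=> hA /(capAL hA)[c ->]; rewrite linearZ /= rmorph1 mulr1. Qed.

Lemma counit_alg_tlift (V W : lmodType k) (f : V -> W -> H) x :
  (counit (tlift f x))%:A = tlift (fun v w => (counit (f v w))%:A : H) x.
Proof. by rewrite /tlift /eval_sum linear_sum scaler_suml. Qed.

Lemma commutator_scalar a l : a \in A -> l \in L ->
  tlift (fun l1 l2 =>
    tlift (fun a1 a2 => a1 * l1 * antipode a2) (comul a) * antipode l2) (comul l) =
  counit l *: (counit a)%:A.
Proof.
move=> aA lL; set x := tlift _ _.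
(* Group as [(a1 l1 S(a2)) S(l2)]: normality of [L]. *)
have xL : x \in L.
  have [s [sL lE]] := hopf_sub_comul lL.
  rewrite /x lE tlift_sum_tens; last first.
    split=> [w|v] c y z; last by rewrite linearP mulrDr -scalerAr.
    rewrite scalerAl -mulrDl; congr (_ * _); apply: tlift_param => a1 a2.
    by rewrite mulrDr !mulrDl -scalerAr -!scalerAl.
  apply: hopf_sub_sum sL => p /andP[p1 p2].
  by apply: hopf_sub_mul; [exact: (nL _ p1).1 | exact: hopf_sub_antipode].
(* Group as [a1 (l1 S(a2) S(l2))]: normality of [A]. *)
have xA : x \in A.
  have [s [sA aE]] := hopf_sub_comul aA.
  rewrite /x; under eq_tlift do rewrite tlift_mulr.
  rewrite tlift_exchange aE tlift_sum_tens; last first.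
    split=> [w|v] c y z; apply: tlift_param => l1 l2.
      by rewrite !mulrDl -!scalerAl.
    by rewrite linearP mulrDr mulrDl -scalerAr -scalerAl.
  apply: hopf_sub_sum sA => p /andP[p1 p2].
  under eq_tlift do rewrite /= -2!mulrA.
  rewrite -tlift_mull.
  by apply: hopf_sub_mul => //; apply: (nA _ _).1; apply: hopf_sub_antipode.
rewrite (cap_scalar xA xL) /x counit_alg_tlift.
rewrite -(@tlift_counitl _ _ _ (fun h => counit h *: (counit a)%:A) l); last first.
  by move=> c y z; rewrite linearP scalerDl !scalerA ?mulrA.
have counit_ad m : counit (tlift (fun a1 a2 => a1 * m * antipode a2) (comul a)) =
    counit m * counit a.
  (* The scalar identity is tested in [H] through the injection [c |-> c 1], where the counit of a
     Sweedler sum is again a Sweedler sum. *)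
  apply: (fmorph_inj (in_alg H)); rewrite /= counit_alg_tlift.
  rewrite -(@tlift_counitl _ _ _ (fun h => (counit m * counit h)%:A)).
    apply: eq_tlift => a1 a2; rewrite !rmorphM /= counit_antipode scalerA.
    by rewrite mulrA.
  by move=> c y z; rewrite linearP mulrDr scalerDl scalerA mulrCA.
apply: eq_tlift => l1 l2; rewrite rmorphM /= counit_antipode counit_ad.
by rewrite !scalerA mulrAC mulrA.
Qed.

(** [adjoint_mul] is used twice on the commutator identity: over [L] it removes [S(l2)], leaving
    [a1 l S(a2) = counit(a) l], and over [A] it removes [S(a2)]. *)
Lemma normal_commute a l : a \in A -> l \in L -> a * l = l * a.
Proof.
move=> aA lL; apply: (adjoint_mul (f := fun a => a * l)) aA => [c x y|b bA].
  by rewrite mulrDl -scalerAl.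
rewrite -[RHS]mulr_algl; move: l lL; apply: adjoint_mul => [c x y|l lL].
  by apply: tlift_param => v w; rewrite mulrDr !mulrDl -scalerAr -!scalerAl.
exact: commutator_scalar.
Qed.

(** [lam(a1 l) a2] lies in [A], and equals [lam(a l1) S(l2)], which lies in [L]; it is therefore
    scalar, and its counit is [lam(a l)]. *)
Lemma integral_sub (lam : {linear H -> k | *%R}) (a : sub_hopf A) l :
  integral lam -> l \in L ->
  tlift (fun a1 a2 => lam (hopf_incl a1 * l) *: a2) (comul a) =
  (lam (hopf_incl a * l))%:A.
Proof.
move=> lam_int lL; apply: hopf_incl_inj.
have bil (m : H) : bilinear_map (fun x y : H => lam (x * m) *: y).
  split=> [w|v] c x y; last by rewrite scalerDr !scalerA mulrC.
  by rewrite mulrDl -scalerAl linearP scalerDl scalerA.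
have bir (m : H) : bilinear_map (fun x y : H => lam (m * x) *: antipode y).
  split=> [w|v] c x y; last by rewrite linearP scalerDr !scalerA mulrC.
  by rewrite mulrDr -scalerAr linearP scalerDl scalerA.
set z := hopf_incl (tlift _ _).
have zE : z = tlift (fun x y => lam (x * l) *: y) (comul (hopf_incl a)).
  rewrite (hopf_morphism_comul (hopf_incl_morphism A)) tlift_tmap //.
  by rewrite /z linear_tlift; apply: eq_tlift => x y; rewrite linearZ.
have zA : z \in A by apply: valP.
have zL : z \in L.
  rewrite zE integral_antipode //.
  pose l' : sub_hopf L := Sub l lL.
  suff -> : tlift (fun x y => lam (hopf_incl a * x) *: antipode y) (comul l) =
      hopf_incl (tlift (fun x y : sub_hopf L =>
        lam (hopf_incl a * hopf_incl x) *: (antipode y : sub_hopf L)) (comul l')).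
    exact: valP.
  rewrite -[l]/(hopf_incl l') (hopf_morphism_comul (hopf_incl_morphism L)) tlift_tmap //.
  by rewrite linear_tlift; apply: eq_tlift => x y; rewrite linearZ.
rewrite (cap_scalar zA zL) linearZ /= rmorph1 zE counit_alg_tlift.
rewrite -(@tlift_counitr _ _ _ (fun x => (lam (x * l))%:A)); last first.
  by move=> c x y; rewrite mulrDl -scalerAl linearP scalerDl scalerA.
by apply: eq_tlift => x y; rewrite linearZ /= scalerA mulrC.
Qed.
End Factorization.

(** * The multiplication map [A (x) L -> H] *)

Lemma tlift_tmid (k : fieldType) (V V' W W' U : lmodType k)
    (f : tensor V W -> tensor V' W' -> U) p q : bilinear_map f ->
  tlift f (tmid (tens p q)) =
  tlift (fun v v' => tlift (fun w w' => f (tens v w) (tens v' w')) q) p.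
Proof.
move=> [fl fr]; have bf := conj fl fr : bilinear_map f.
have b1 (v : V) (v' : V') : bilinear_map (fun w w' => f (tens v w) (tens v' w')).
  by split=> [w'|w] c x y; rewrite tens_linr ?fl ?fr.
have b2 : bilinear_map
    (fun v v' => tlift (fun w w' => f (tens v w) (tens v' w')) q).
  by split=> [v'|v] c x y; apply: tlift_param => w w'; rewrite tens_linl ?fl ?fr.
elim/tensor_ind: p => [|x y IHx IHy|v v'] in b2 *.
- by rewrite tens0l linear0 !tlift0.
- by rewrite tensDl linearD /= !tliftD // IHx // IHy.
rewrite tlift_tens // {b2}; elim/tensor_ind: q => [|x y IHx IHy|w w'].
- by rewrite tens0r linear0 !tlift0.
- by rewrite tensDr linearD /= !tliftD // IHx // IHy.
by rewrite tmidE !tlift_tens.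
Qed.

Section MulMap.
Variables (k : fieldType) (H : hopfAlgType k) (A L : hopfSubalgebra H).
Local Notation AL := (tensor_hopf (sub_hopf A) (sub_hopf L)).

Fact mul_map_linear : linear (@mul_map k H A L).
Proof. by apply: tlift_linear; apply: bilinear_mul. Qed.

HB.instance Definition _ :=
  GRing.isLinear.Build k AL H _ (@mul_map k H A L) mul_map_linear.

Let comul_tens a l :
  comul (tens a l : AL) = tmid (tens (comul a) (comul l)) := tensor_comulE a l.

Let counit_tens a l : counit (tens a l : AL) = counit a * counit l :=
  tensor_counitE a l.

(** On [a (x) l] both sides are [a1 l1 (x) a2 l2]: [comul] is multiplicative on [H], and [tmid]
    swaps the middle factors. *)
Lemma mul_map_comul (x : AL) :
  comul (mul_map x) = tmap (@mul_map k H A L) (@mul_map k H A L) (comul x).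
Proof.
elim/tensor_ind: x => [|x y IHx IHy|a l].
- by rewrite !linear0.
- by rewrite !linearD /= IHx IHy.
rewrite mul_mapE rmorphM /= (hopf_morphism_comul (hopf_incl_morphism A)).
rewrite (hopf_morphism_comul (hopf_incl_morphism L)) tensor_comulE.
elim/tensor_ind: (comul a) => [|p p' IHp IHp'|a1 a2].
- by rewrite tens0l !linear0 mul0r.
- by rewrite tensDl !linearD /= mulrDl IHp IHp'.
elim/tensor_ind: (comul l) => [|q q' IHq IHq'|l1 l2].
- by rewrite tens0r !linear0 mulr0.
- by rewrite tensDr !linearD /= mulrDr IHq IHq'.
by rewrite tmidE !tmapE tensM /= !mul_mapE.
Qed.

Lemma mul_map_counit (x : AL) : counit (mul_map x) = counit x.
Proof.
elim/tensor_ind: x => [|x y IHx IHy|a l].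
- by rewrite !linear0.
- by rewrite !linearD /= IHx IHy.
by rewrite mul_mapE rmorphM counit_tens.
Qed.

Lemma mul_map_surj h : in_prod_span A L h -> exists x : AL, h = mul_map x.
Proof.
move=> [s [sAL ->]]; elim: s sAL => [_|p s IHs /= /andP[/andP[pA pL] /IHs[x xE]]].
  by exists 0; rewrite big_nil linear0.
exists (tens (Sub p.1 pA : sub_hopf A) (Sub p.2 pL : sub_hopf L) + x).
by rewrite big_cons xE linearD /= mul_mapE.
Qed.

Lemma mul_map_monoid :
  (forall a l, a \in A -> l \in L -> a * l = l * a) ->
  monoid_morphism (@mul_map k H A L).
Proof.
move=> comm; split=> [|x y]; first by rewrite -tens1 mul_mapE !rmorph1 mulr1.
elim/tensor_ind: x => [|x x' IHx IHx'|a l].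
- by rewrite mul0r linear0 mul0r.
- by rewrite mulrDl !linearD /= mulrDl IHx IHx'.
elim/tensor_ind: y => [|y y' IHy IHy'|b m].
- by rewrite mulr0 linear0 mulr0.
- by rewrite mulrDr !linearD /= mulrDr IHy IHy'.
rewrite tensM !mul_mapE !rmorphM -!mulrA; congr (_ * _); rewrite !mulrA.
by congr (_ * _); apply: comm; apply: valP.
Qed.

Lemma integral_mul_map (lam : {linear H -> k | *%R}) (lamM : {linear AL -> k | *%R}) :
  (forall h : H, h \in A -> h \in L -> exists c : k, h = c%:A) ->
  (forall a l, a \in A -> l \in L -> a * l = l * a) ->
  integral lam -> (forall x, lamM x = lam (mul_map x)) -> integral lamM.
Proof.
move=> cap comm lam_int lamME z; have b_lamM := bilinear_scalel AL lamM.
elim/tensor_ind: z => [|u v IHu IHv|a l].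
- by rewrite !linear0 scale0r tlift0.
- by rewrite !linearD /= scalerDl tliftD // IHu IHv.
rewrite comul_tens tlift_tmid // tlift_exchange.
(* Summing over [a] first, [lam(a1 l1) a2 = lam(a l1) 1]. *)
transitivity (tlift (fun l1 l2 : sub_hopf L =>
  lam (hopf_incl a * hopf_incl l1) *: tens (1 : sub_hopf A) l2) (comul l)).
  apply: eq_tlift => l1 l2; rewrite -tensZl.
  rewrite -(integral_sub cap a lam_int (valP l1)).
  rewrite (tlift_bilinearl _ _ _ (tens_bilinear _ _)).
  by apply: eq_tlift => a1 a2; rewrite tensZl lamME mul_mapE.
rewrite lamME mul_mapE (comm _ _ (valP a) (valP l)).
rewrite -[RHS]/(_ *: tens (1 : sub_hopf A) (1 : sub_hopf L)) -tensZr.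
(* The same with [A] and [L] exchanged, after commuting [a] past [l]:
   [lam(l1 a) l2 = lam(l a) 1]. *)
rewrite -(integral_sub (fun h hL hA => cap h hA hL) l lam_int (valP a)).
rewrite (tlift_bilinearl _ _ _ (bilinear_flip (tens_bilinear _ _))).
by apply: eq_tlift => l1 l2; rewrite tensZr (comm _ _ (valP a) (valP l1)).
Qed.
End MulMap.

Theorem theorem3p5 (k : closedFieldType) (char_k : [pchar k] =i pred0)
  (H : hopfAlgType k) (ssH : semisimple H) (A L : hopfSubalgebra H)
  (nA : normal_hopf_subalgebra A) (nL : normal_hopf_subalgebra L)
  (HAL : forall h : H, in_prod_span A L h)
  (capAL : forall h : H, (h \in A /\ h \in L) <-> (exists c : k, h = c%:A)) :
  hopf_isomorphism (@mul_map k H A L).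
Proof.
have cap h : h \in A -> h \in L -> exists c : k, h = c%:A.
  by move=> hA hL; apply/capAL.
have comm := normal_commute nA nL cap.
have [m1 mM] := mul_map_monoid comm.
split.
  apply: bialgebra_morphism_hopf => //; first exact: mul_map_linear.
    exact: mul_map_comul.
  exact: mul_map_counit.
apply: inj_surj_bijective => [x y|h]; last exact: mul_map_surj.
move=> xy; apply/eqP; rewrite -subr_eq0; apply/eqP.
have [lam [lam_int [h lamh]]] := integral_exists ssH.
have [lamM lamME] : exists g : {linear tensor_hopf (sub_hopf A) (sub_hopf L) -> k | *%R},
    forall x, g x = lam (mul_map x).
  by apply: scalar_linear => c u v; rewrite mul_map_linear linearP.
(* [lam] composed with multiplication is nonzero by surjectivity, and it vanishes on the right ideal
   generated by [x - y], which multiplication sends to [0]. *)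
apply: (integral_nondegenerate (integral_mul_map cap comm lam_int lamME)) => [|z].
  by have [u hE] := mul_map_surj (HAL h); exists u; rewrite lamME -hE.
by rewrite lamME mM linearB /= xy subrr mul0r linear0.
Qed.
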